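(* There exists an absolute constant $c > 0$ such that the following holds. Let $d \geq 2$ be an integer and let $\{K_1, \ldots, K_n\}$ be a finite family of closed convex sets in $\mathbb{R}^d$ such that their intersection $K = K_1 \cap \cdots \cap K_n$ is a convex body. Then there exists a set $\sigma \subseteq \{1, \ldots, n\}$ with cardinality at most $2d$ such that both $$\operatorname{vol}_d K_\sigma \leq (c d)^{3d/2} \operatorname{vol}_d K \quad\text{and}\quad \operatorname{diam} K_\sigma \leq 2 d^2 \operatorname{diam} K,$$ where $K_\sigma = \bigcap_{i \in \sigma} K_i$.
   Context: A convex body in $\mathbb{R}^d$ is a compact convex set with non-empty interior. $\operatorname{vol}_d$ denotes $d$-dimensional volume (Lebesgue measure) and $\operatorname{diam}$ denotes Euclidean diameter. The intersection over the empty index set is $\mathbb{R}^d$. *)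

(* Defs.v *)
From HB Require Import structures.
From mathcomp Require Import all_boot all_order all_algebra.
From mathcomp Require Import all_classical all_reals all_analysis.

Set Implicit Arguments.
Unset Strict Implicit.
Unset Printing Implicit Defensive.
Import Order.TTheory GRing.Theory Num.Theory.
Import numFieldNormedType.Exports.

Local Open Scope classical_set_scope.
Local Open Scope ring_scope.

Section lebesgue_cons.
Local Open Scope ereal_scope.
Context (R : realType) (n : nat).
Local Notation RT := (measurableTypeR R).
Variable m : {sigma_finite_measure set (n.-tuple RT) -> \bar R}.

Let tcons (p : RT * n.-tuple RT) : n.+1.-tuple RT := [tuple of p.1 :: p.2].

Let tuncons (t : n.+1.-tuple RT) : RT * n.-tuple RT :=
  (thead t, [tuple of behead t]).

Let measurable_tcons : measurable_fun [set: RT * n.-tuple RT] tcons.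
Proof. exact: measurable_cons. Qed.

Let measurable_tuncons : measurable_fun [set: n.+1.-tuple RT] tuncons.
Proof.
apply/measurable_fun_pairP; split; first exact: measurable_tnth.
exact: measurable_behead.
Qed.

(* The product of one-dimensional Lebesgue measure and m, carried to
   (n+1)-tuples along (x, t) |-> x :: t. *)
Definition lebesgue_cons : set (n.+1.-tuple RT) -> \bar R :=
  pushforward (@lebesgue_measure R \x m) tcons.

Let lebesgue_cons0 : lebesgue_cons set0 = 0.
Proof. by rewrite /lebesgue_cons /pushforward preimage_set0 measure0. Qed.

Let lebesgue_cons_ge0 A : 0 <= lebesgue_cons A.
Proof. exact: measure_ge0. Qed.

Let lebesgue_cons_sigma_additive : semi_sigma_additive lebesgue_cons.
Proof.
pose mu : {measure set (RT * n.-tuple RT)%type -> \bar R} := (@lebesgue_measure R \x m).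
pose f : {mfun (RT * n.-tuple RT)%type >-> (n.+1.-tuple RT)} :=
  HB.pack tcons (isMeasurableFun.Build _ _ _ _ tcons measurable_tcons).
exact: (@measure_semi_sigma_additive _ _ _ (pushforward mu f)).
Qed.

HB.instance Definition _ := isMeasure.Build _ _ _ lebesgue_cons
  lebesgue_cons0 lebesgue_cons_ge0 lebesgue_cons_sigma_additive.

(* Not inferred: the canonical sigma-finite structure on _ \x _ is the one for
   products of subprobabilities. *)
Let lebesgue_cons_sigma_finite : sigma_finite [set: n.+1.-tuple RT] lebesgue_cons.
Proof.
have /sigma_finiteP[F [TF ndF Foo]] := sigma_finiteT (@lebesgue_measure R).
have /sigma_finiteP[G [TG ndG Goo]] := sigma_finiteT m.
have tconsK : cancel tcons tuncons.
  by case=> x t; congr pair; apply/val_inj.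
exists (fun k => tuncons @^-1` (F k `*` G k)).
  rewrite -preimage_bigcup (_ : \bigcup_k (F k `*` G k) = setT)//.
  apply/seteqP; split=> // -[x t] _.
  have [i _ Fix] : (\bigcup_k F k) x by rewrite -TF.
  have [j _ Gjt] : (\bigcup_k G k) t by rewrite -TG.
  exists (maxn i j) => //; split => /=.
    by move: x Fix; exact/subsetPset/ndF/leq_maxl.
  by move: t Gjt; exact/subsetPset/ndG/leq_maxr.
move=> k; have [mF Fk] := Foo k; have [mG Gk] := Goo k; split.
  rewrite -[X in measurable X]setTI; apply: measurable_tuncons => //.
  exact: measurableX.
rewrite /lebesgue_cons /pushforward -comp_preimage.
rewrite (_ : tuncons \o tcons = id); last exact/funext.
by rewrite preimage_id product_measure1E// lte_mul_pinfty// ge0_fin_numE.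
Qed.

HB.instance Definition _ := Measure_isSigmaFinite.Build _ _ _ lebesgue_cons
  lebesgue_cons_sigma_finite.

End lebesgue_cons.

Fixpoint lebesgue_tuple (R : realType) (n : nat) :
    {sigma_finite_measure set (n.-tuple (measurableTypeR R)) -> \bar R} :=
  match n with
  | 0 => \d_([tuple] : 0.-tuple (measurableTypeR R))
  | n'.+1 => lebesgue_cons (lebesgue_tuple R n')
  end.

Section lebesgue_tuple_box.
Local Open Scope ereal_scope.
Context (R : realType).
Local Notation RT := (measurableTypeR R).

Lemma lebesgue_tupleS n (A : set (n.+1.-tuple RT)) :
  lebesgue_tuple R n.+1 A =
  (@lebesgue_measure R \x lebesgue_tuple R n)
    [set p : RT * n.-tuple RT | A [tuple of p.1 :: p.2]].
Proof. by []. Qed.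

Lemma measurable_tuple_box n (B : 'I_n -> set RT) :
  (forall i, measurable (B i)) ->
  measurable [set t : n.-tuple RT | forall i, B i (tnth t i)].
Proof.
move=> mB.
rewrite (_ : [set t | _] = \bigcap_(i in [set: 'I_n]) ((@tnth n RT)^~ i @^-1` B i)).
  apply: fin_bigcap_measurable => // i _.
  by rewrite -[X in measurable X]setTI; exact: measurable_tnth.
by apply/seteqP; split=> t /= Bt i => [_|]; exact: Bt.
Qed.

Lemma lebesgue_tuple_box n (B : 'I_n -> set RT) :
  (forall i, measurable (B i)) ->
  lebesgue_tuple R n [set t | forall i, B i (tnth t i)] =
  \prod_(i < n) @lebesgue_measure R (B i).
Proof.
elim: n B => [|n IHn] B mB.
  rewrite big_ord0 /= diracE mem_set//; by case.
rewrite big_ord_recl lebesgue_tupleS.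
rewrite (_ : [set p | _] = B ord0 `*`
    [set t : n.-tuple RT | forall i : 'I_n, B (lift ord0 i) (tnth t i)]).
  rewrite product_measure1E//; first by congr (_ * _); exact: IHn.
  apply: (@measurable_tuple_box _ (fun i => B (lift ord0 i))) => i.
  exact: mB.
apply/seteqP; split=> -[x t] /=.
  move=> Bxt; split; first exact: (Bxt ord0).
  by move=> i; have := Bxt (lift ord0 i); rewrite tnthS.
move=> [Bx Bt] i; case: (unliftP ord0 i) => [j ->|-> //].
by rewrite tnthS.
Qed.

End lebesgue_tuple_box.

Section euclidean.
Context (R : realType) (d : nat).
Implicit Types (x y : 'rV[R]_d) (A : set 'rV[R]_d).

Definition volume A : \bar R :=
  lebesgue_tuple R d [set t | A (\row_i tnth t i)].

(* The norm that the library puts on 'rV[R]_d is the sup norm, which induces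
   the usual topology but not the Euclidean distance. *)
Definition enorm x : R := Num.sqrt (\sum_(i < d) x ord0 i ^+ 2).

(* Valued in \bar R so that an unbounded set has diameter +oo. *)
Definition diameter A : \bar R :=
  ereal_sup [set (enorm (x - y))%:E | x in A & y in A].

Definition convex A : Prop := convex_set (A : set (convex_lmodType 'rV[R]_d)).

Definition convex_body A : Prop := [/\ compact A, convex A & A° !=set0].

End euclidean.

(* Main.v *)
Require Import Defs.
From HB Require Import structures.
From mathcomp Require Import all_boot all_order all_algebra perm.
From mathcomp Require Import all_classical all_reals all_analysis.
From mathcomp Require Import measurable_realfun ring lra.

(** The proof works in the polar picture.  Write [K] for the intersection.

    A point [p] is chosen in the interior of [K] with
    [K - p] contained in [- d *: (K - p)]: the centroid of a simplex of maximal
    volume inscribed in [K] has this property ([minkowski_center]).  After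
    translating [p] to 0, let [V] be the union of the polars of the [K i]; it
    is compact, and [x] lies in every [K i] as soon as [dot q x <= 1] for all
    [q] in [V].  Selecting [2 * d] of the sets amounts to selecting [2 * d]
    points of [V].

    The first [d] points are the rows of a matrix [X] of maximal [`|\det X|]
    among the matrices with rows in [V] ([max_det_basis]); by Cramer's rule
    every [q] in [V] is then a combination of the rows of [X] with coefficients
    in [[-1, 1]].  Let [u] be the sum of the rows of [X].  The inclusion
    [K] in [- d *: K] puts [- u / d ^ 2] into the closed convex hull of [V] and
    0, and a conic form of Caratheodory's theorem expresses it through only [d]
    points of [V]: these are the remaining ones ([antipode_hull]).

    Diameter.  If [x] satisfies the [2 * d] selected inequalities, then
    [dot u x >= - d ^ 2].  Writing [q] as the combination with coefficients
    [b j], the number [dot q (- x)] is the sum over [j] of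
    [(1 - b j) * dot (row j X) x], minus [dot u x], hence at most
    [2 * d + d ^ 2].  So the selected intersection is contained in
    [- (d * (d + 2)) *: K], and [d * (d + 2) <= 2 * d ^ 2] ([sparse_selection],
    [diameter_antihomothety]).

    Volume, upper bound.  The same inequalities confine [x] to a simplex: the
    numbers [1 - dot (row i X) x] are nonnegative with sum at most
    [d * (d + 1)].  A cover by cubes of edge [d + 1] shows that this simplex has
    volume at most [4 ^ d * (d + 1) ^ d / `|\det X|] ([volume_simplex]).

    Volume, lower bound.  Let [M] nearly maximise the determinant among the
    sums of [c j *: v j ^T *m v j] with [v j] in [V] and weights of sum at most
    1.  Maximality bounds [q *m invmx M *m q^T] on [V], which places an
    ellipsoid, and hence a parallelepiped, inside [K]; and the Cauchy-Binet
    expansion gives [d`! * \det M <= \det X ^ 2] ([dual_cube]).  This factor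
    [d`!], of order [d ^ d], is the reason for the exponent [3 * d / 2].

    Volumes of parallelepipeds come from the affine change of variables
    [volume_affine], proved by Gaussian elimination and Fubini's theorem. *)

Set Implicit Arguments.
Unset Strict Implicit.
Unset Printing Implicit Defensive.
Import Order.TTheory GRing.Theory Num.Theory.
Import numFieldNormedType.Exports.

Local Open Scope classical_set_scope.
Local Open Scope ring_scope.

(** * Inner product and convexity *)

Definition dot (R : pzRingType) n (x y : 'rV[R]_n) : R := (x *m y^T) 0 0.

Section dot.
Variables (R : realFieldType) (n : nat).
Implicit Types x y z : 'rV[R]_n.

Lemma dotE x y : dot x y = \sum_i x 0 i * y 0 i.
Proof. by rewrite /dot mxE; apply: eq_bigr => i _; rewrite mxE. Qed.

Lemma dotC x y : dot x y = dot y x.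
Proof. by rewrite !dotE; apply: eq_bigr => i _; rewrite mulrC. Qed.

Lemma dotDl x y z : dot (x + y) z = dot x z + dot y z.
Proof. by rewrite /dot mulmxDl mxE. Qed.

Lemma dotZl a x y : dot (a *: x) y = a * dot x y.
Proof. by rewrite /dot -scalemxAl mxE. Qed.

Lemma dotNl x y : dot (- x) y = - dot x y.
Proof. by rewrite /dot mulNmx mxE. Qed.

Lemma dot0l x : dot 0 x = 0.
Proof. by rewrite /dot mul0mx mxE. Qed.

Lemma dotDr x y z : dot x (y + z) = dot x y + dot x z.
Proof. by rewrite dotC dotDl !(dotC x). Qed.

Lemma dotZr a x y : dot x (a *: y) = a * dot x y.
Proof. by rewrite dotC dotZl dotC. Qed.

Lemma dotNr x y : dot x (- y) = - dot x y.
Proof. by rewrite dotC dotNl dotC. Qed.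

Lemma dot0r x : dot x 0 = 0.
Proof. by rewrite dotC dot0l. Qed.

Lemma dot_ge0 x : 0 <= dot x x.
Proof. by rewrite dotE; apply: sumr_ge0 => i _; rewrite -expr2 sqr_ge0. Qed.

Lemma dot_coord x i : x 0 i ^+ 2 <= dot x x.
Proof.
rewrite dotE (bigD1 i)//= -expr2 lerDl.
by apply: sumr_ge0 => j _; rewrite -expr2 sqr_ge0.
Qed.

Lemma dot_gt0 x : x != 0 -> 0 < dot x x.
Proof.
move=> x0; rewrite lt_neqAle dot_ge0 andbT eq_sym; apply: contraNneq x0 => d0.
apply/eqP/rowP => i; rewrite mxE; apply/eqP; rewrite -sqrf_eq0 eq_le sqr_ge0 andbT.
by rewrite -d0 dot_coord.
Qed.

Lemma dot_mulmx N (a : 'rV_N) (W : 'M[R]_(N, n)) x :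
  dot (a *m W) x = \sum_j a 0 j * dot (row j W) x.
Proof.
rewrite /dot -mulmxA mxE; apply: eq_bigr => j _; congr (_ * _).
by rewrite -row_mul [RHS]mxE.
Qed.

Lemma dot_row N (W : 'M[R]_(N, n)) j x : (x *m W^T) 0 j = dot (row j W) x.
Proof. by rewrite dotE mxE; apply: eq_bigr => k _; rewrite !mxE mulrC. Qed.

Lemma dot_suml I (s : seq I) (f : I -> 'rV[R]_n) x :
  dot (\sum_(i <- s) f i) x = \sum_(i <- s) dot (f i) x.
Proof. by elim: s => [|i s IHs]; rewrite ?big_nil ?dot0l// !big_cons dotDl IHs. Qed.

Lemma dot_delta x j : dot x (delta_mx 0 j) = x 0 j.
Proof.
rewrite dotE (bigD1 j)//= mxE !eqxx mulr1 big1 ?addr0// => k kj.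
by rewrite mxE (negbTE kj) andbF mulr0.
Qed.

Lemma scale_delta_le (s : R) (j k : 'I_n) :
  `|(s *: delta_mx 0 j : 'rV[R]_n) 0 k| <= `|s|.
Proof.
by rewrite !mxE eqxx /= normrM; case: eqP; rewrite ?normr1 ?mulr1// normr0 mulr0.
Qed.

End dot.

Definition segment_closed (R : numDomainType) n (C : set 'rV[R]_n) :=
  forall x y t, C x -> C y -> 0 <= t <= 1 -> C (t *: x + (1 - t) *: y).

Lemma convex_segment_closed (R : realType) n (C : set 'rV[R]_n) :
  convex C -> segment_closed C.
Proof.
move=> cC x y t Cx Cy /andP[t0 t1].
pose l : {i01 R} := Itv01 t0 t1.
have := cC x y l; rewrite !inE => /(_ Cx Cy).
by rewrite /conv /=.
Qed.

Lemma segment_closed_translate (R : realType) n (A : set 'rV[R]_n) p :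
  segment_closed A -> segment_closed [set x | A (p + x)].
Proof.
move=> sA x y t /= Ax Ay t01; have := sA _ _ t Ax Ay t01; congr A.
by rewrite !scalerDr addrACA -scalerDl (addrCA t) subrr addr0 scale1r.
Qed.

Lemma convex_comb (R : realType) m (A : set 'rV[R]_m) N (a : 'rV[R]_N) (W : 'M[R]_(N, m)) :
  segment_closed A ->
  (forall j, 0 <= a 0 j) -> \sum_j a 0 j = 1 -> (forall j, A (row j W)) -> A (a *m W).
Proof.
move=> cA; elim: N a W => [|N IHN] a W a0 a1 AW.
  by move/eqP: a1; rewrite big_ord0 eq_sym oner_eq0.
rewrite -[N.+1]/(1 + N)%N in a W a0 a1 AW *.
have AW0 : A (usubmx W).
  by have := AW (lshift N 0); congr A; apply/rowP => k; rewrite !mxE.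
have AWd j : A (row j (dsubmx W)).
  by have := AW (rshift 1 j); congr A; apply/rowP => k; rewrite !mxE.
pose s := \sum_j rsubmx a 0 j.
have s0 : 0 <= s by apply: sumr_ge0 => j _; rewrite mxE.
have a1' : a 0 (lshift N 0) = 1 - s.
  rewrite -a1 big_split_ord big_ord1 -[LHS]addr0 -addrA; congr (_ + _).
  by rewrite /s /=; under [X in _ - X]eq_bigr do rewrite mxE; rewrite subrr.
have -> : a *m W = (1 - s) *: usubmx W + rsubmx a *m dsubmx W.
  rewrite -{1}[a]hsubmxK -{1}[W]vsubmxK mul_row_col; congr (_ + _).
  by rewrite [lsubmx a]mx11_scalar mul_scalar_mx mxE a1'.
have [s_eq0|sn0] := eqVneq s 0.
  have -> : rsubmx a = 0.
    move/eqP: s_eq0; rewrite psumr_eq0; last by move=> j _; rewrite mxE.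
    move/allP => h; apply/rowP => j; rewrite [RHS]mxE; apply/eqP.
    by apply: h; rewrite mem_index_enum.
  by rewrite s_eq0 subr0 scale1r mul0mx addr0.
rewrite addrC.
have -> : rsubmx a *m dsubmx W = s *: ((s^-1 *: rsubmx a) *m dsubmx W).
  by rewrite -scalemxAl scalerA divff// scale1r.
apply: cA => //.
  apply: IHN => //.
    by move=> j; rewrite !mxE mulr_ge0 ?invr_ge0.
  by under eq_bigr do rewrite mxE; rewrite -mulr_sumr mulVf.
by rewrite s0 -subr_ge0 -a1' a0.
Qed.

(** * Determinants and quadratic forms *)

(** Multilinearity in the rows of the product; this is the first half of the
    Cauchy-Binet formula, before the terms are grouped by the image of [f]. *)
Lemma det_mulmx_sum (R : comPzRingType) n N (A : 'M[R]_(n, N)) (W : 'M[R]_(N, n)) :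
  \det (A *m W) =
  \sum_(f : {ffun 'I_n -> 'I_N}) (\prod_i A i (f i)) * \det (rowsub f W).
Proof.
under eq_bigr do rewrite mulr_sumr.
rewrite exchange_big /=; apply: eq_bigr => s _.
transitivity ((-1) ^+ s * \sum_(f : {ffun 'I_n -> 'I_N})
    \prod_i (A i (f i) * W (f i) (s i))).
  congr (_ * _); rewrite -(bigA_distr_bigA (fun i j => A i j * W j (s i))).
  by apply: eq_bigr => i _; rewrite mxE.
rewrite mulr_sumr; apply: eq_bigr => f _.
rewrite big_split /= mulrCA; congr (_ * (_ * _)).
by apply: eq_bigr => i _; rewrite !mxE.
Qed.

(** The Gram matrix of the weighted rows of [W], that is the sum of
    [c 0 j *: (row j W)^T *m row j W] over [j]. *)
Definition gram (R : pzSemiRingType) n N (c : 'rV[R]_N) (W : 'M[R]_(N, n)) : 'M[R]_n :=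
  W^T *m diag_mx c *m W.

(** Averaging the Cauchy-Binet expansion over all permutations of the columns
    makes both determinants in each term equal. *)
Lemma fact_det_gram (R : comPzRingType) n N (c : 'rV[R]_N) (W : 'M[R]_(N, n)) :
  n`!%:R * \det (gram c W) =
  \sum_(f : {ffun 'I_n -> 'I_N}) (\prod_i c 0 (f i)) * \det (rowsub f W) ^+ 2.
Proof.
pose G (s : 'S_n) := \sum_(f : {ffun 'I_n -> 'I_N})
  (\prod_i c 0 (f i)) * ((-1) ^+ s * \prod_i W (f (s i)) i) * \det (rowsub f W).
(* The sum over f is reindexed by f \o s, which leaves the weight unchanged
   and multiplies the minor by the signature of s. *)
have GE s : \det (gram c W) = G s.
  rewrite det_mulmx_sum /G.
  rewrite (reindex_inj (h := fun f : {ffun 'I_n -> 'I_N} => [ffun i => f (s i)])) /=; last first.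
    move=> f g /ffunP fg; apply/ffunP => i.
    by have := fg ((s^-1)%g i); rewrite !ffunE permKV.
  apply: eq_bigr => f _.
  have -> : rowsub [ffun i => f (s i)] W = row_perm s (rowsub f W).
    by apply/matrixP => i j; rewrite !mxE ffunE.
  rewrite row_permE det_mulmx det_perm !mulrA; congr (_ * _).
  rewrite -!mulrA [RHS]mulrCA; rewrite mulrC; congr (_ * _).
  rewrite [X in _ = X * _](reindex_inj (@perm_inj _ s)) -big_split /=.
  by apply: eq_bigr => i _; rewrite mul_mx_diag !mxE !ffunE mulrC.
rewrite mulr_natl -card_Sn -sumr_const.
under eq_bigr => s _ do rewrite (GE s).
rewrite exchange_big /=; apply: eq_bigr => f _.
rewrite -mulr_suml -mulr_sumr -mulrA expr2; congr (_ * (_ * _)).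
rewrite -[RHS]det_tr; apply: eq_big => [s|s _]; first by rewrite inE.
by congr (_ * _); apply: eq_bigr => i _; rewrite !mxE.
Qed.

Lemma det_gram_le (R : realFieldType) n N (c : 'rV[R]_N) (W : 'M[R]_(N, n)) D :
  (forall j, 0 <= c 0 j) -> \sum_j c 0 j <= 1 ->
  (forall f : 'I_n -> 'I_N, `|\det (rowsub f W)| <= D) ->
  n`!%:R * \det (gram c W) <= D ^+ 2.
Proof.
move=> c0 c1 WD; rewrite fact_det_gram.
apply: (@le_trans _ _ (\sum_(f : {ffun 'I_n -> 'I_N}) (\prod_i c 0 (f i)) * D ^+ 2)).
  apply: ler_sum => f _; apply: ler_wpM2l; first exact: prodr_ge0.
  by rewrite -real_normK ?num_real// lerXn2r ?nnegrE ?(le_trans _ (WD f)).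
rewrite -mulr_suml -[X in _ <= X]mul1r ler_wpM2r ?sqr_ge0//.
rewrite -(bigA_distr_bigA (fun _ j => c 0 j)) prodr_const card_ord.
by rewrite exprn_ile1// sumr_ge0.
Qed.

Lemma gram_adjoin (R : comNzRingType) n N (c : 'rV[R]_N) (W : 'M[R]_(N, n)) (q : 'rV[R]_n) t :
  gram (row_mx ((1 - t) *: c) t%:M) (col_mx W q) = (1 - t) *: gram c W + t *: (q^T *m q).
Proof.
rewrite /gram tr_col_mx diag_mx_row mul_row_block !mulmx0 addr0 add0r.
rewrite mul_row_col; congr (_ + _).
  by rewrite linearZ /= -scalemxAr -scalemxAl.
rewrite (_ : diag_mx t%:M = t%:M) ?mul_mx_scalar ?scalemxAl//.
by apply/matrixP => i j; rewrite !ord1 !mxE eqxx !mulr1n.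
Qed.

Section gram_form.
Variables (R : realFieldType) (n N : nat) (c : 'rV[R]_N) (W : 'M[R]_(N, n)).

Lemma gram_sym : (gram c W)^T = gram c W.
Proof. by rewrite /gram !trmx_mul trmxK tr_diag_mx mulmxA. Qed.

Lemma gram_quad (x : 'rV[R]_n) :
  (x *m gram c W *m x^T) 0 0 = \sum_j c 0 j * dot (row j W) x ^+ 2.
Proof.
have -> : x *m gram c W *m x^T = x *m W^T *m diag_mx c *m (x *m W^T)^T.
  by rewrite trmx_mul trmxK /gram !mulmxA.
rewrite mxE; apply: eq_bigr => j _.
by rewrite mul_mx_diag mxE [_^T _ _]mxE dot_row; ring.
Qed.

Lemma gram_posdef (x : 'rV[R]_n) : (forall j, 0 <= c 0 j) -> gram c W \in unitmx ->
  x != 0 -> 0 < (x *m gram c W *m x^T) 0 0.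
Proof.
move=> c0 uM x0; rewrite lt_neqAle gram_quad sumr_ge0 ?andbT; last first.
  by move=> j _; rewrite mulr_ge0// sqr_ge0.
apply: contraNneq x0 => /esym/eqP.
rewrite psumr_eq0; last by move=> j _; rewrite mulr_ge0// sqr_ge0.
move=> /allP h.
suff : x *m gram c W = 0 by move/(congr1 (mulmx^~ (invmx (gram c W)))); rewrite mulmxK// mul0mx => ->.
rewrite /gram !mulmxA; suff -> : x *m W^T *m diag_mx c = 0 by rewrite mul0mx.
apply/rowP => j; rewrite mul_mx_diag mxE [RHS]mxE dot_row.
have := h j; rewrite mem_index_enum mulf_eq0 => /(_ isT) /orP[/eqP ->|]; first by rewrite mulr0.
by rewrite sqrf_eq0 => /eqP ->; rewrite mul0r.
Qed.

End gram_form.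

(** The matrix determinant lemma: both sides are the determinant of the same
    bordered matrix, reduced by row and by column operations. *)
Lemma det_rank1_update (R : comUnitRingType) n (A : 'M[R]_n) (u : 'cV[R]_n) (v : 'rV[R]_n) :
  A \in unitmx -> \det (A + u *m v) = \det A * (1 + (v *m invmx A *m u) 0 0).
Proof.
move=> uA.
pose B := block_mx (1%:M : 'M[R]_1) (- v) u A.
have E1 : block_mx 1%:M 0 (- u) 1%:M *m B = block_mx 1%:M (- v) 0 (A + u *m v).
  rewrite /B mulmx_block !mul1mx !mul0mx !addr0 mulmx1 addNr.
  by rewrite mulNmx mulmxN opprK addrC.
have E2 : block_mx (1%:M + v *m invmx A *m u) (- v) 0 A *m block_mx 1%:M 0 (invmx A *m u) 1%:M = B.
  rewrite /B mulmx_block !mulmx1 !mul0mx !mulmx0 !add0r [A *m _]mulmxA mulmxV// mul1mx.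
  by rewrite mulNmx mulmxA addrK.
have := congr1 determinant E1; rewrite det_mulmx det_lblock !det1 !mul1r.
rewrite det_ublock det1 mul1r => <-.
rewrite -E2 det_mulmx det_ublock det_lblock !det1 !mulr1 det_mx11 mulrC.
by congr (_ * _); rewrite !mxE eqxx.
Qed.

(** Induction on the size; the Schur complement of the first pivot inherits
    positivity, tested on the vectors that minimise the form over their first
    coordinate. *)
Lemma cholesky (R : rcfType) n (M : 'M[R]_n) :
  M^T = M -> (forall x : 'rV_n, x != 0 -> 0 < (x *m M *m x^T) 0 0) ->
  exists L : 'M[R]_n, M = L *m L^T.
Proof.
elim: n M => [|n IHn] M sM pM; first by exists 0; apply/matrixP => -[].
rewrite -[n.+1]/(1 + n)%N in M sM pM *.
pose a := M 0 0; pose b := ursubmx M; pose D := drsubmx M.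
have ME : M = block_mx a%:M b b^T D.
  rewrite -[LHS]submxK /b trmx_ursub sM; congr (block_mx _ _ _ _).
  by apply/matrixP => i j; rewrite !ord1 !mxE !lshift0 eqxx.
have a0 : 0 < a.
  have := pM (row_mx 1%:M 0); rewrite ME tr_row_mx mul_row_block !mul1mx !mul0mx !addr0.
  rewrite mul_row_col trmx1 mulmx1 trmx0 mulmx0 addr0 mxE eqxx; apply.
  apply/eqP => /rowP /(_ 0); rewrite mxE; case: splitP => // j _.
  by rewrite !mxE ord1 eqxx => /eqP; rewrite oner_eq0.
have sD : D^T = D by rewrite /D trmx_drsub sM.
pose r := Num.sqrt a; have r0 : r != 0 by rewrite gt_eqF// sqrtr_gt0.
have rr : r * r = a by rewrite -expr2 sqr_sqrtr// ltW.
have [||L' L'E] := IHn (D - a^-1 *: (b^T *m b)).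
- by rewrite linearB linearZ /= trmx_mul trmxK sD.
- move=> y y0; have := pM (row_mx (- a^-1 *: (y *m b^T)) y).
  have -> : (row_mx (- a^-1 *: (y *m b^T)) y *m M *m
     (row_mx (- a^-1 *: (y *m b^T)) y)^T) = y *m (D - a^-1 *: (b^T *m b)) *m y^T.
    rewrite ME tr_row_mx mul_row_block mul_row_col mul_mx_scalar scalerA.
    rewrite mulrN divff ?gt_eqF// scaleN1r addNr mul0mx add0r.
    rewrite mulmxBr -scalemxAl -scalemxAr !scaleNr mulmxA.
    by congr (_ *m _); rewrite addrC.
  apply; apply: contraNneq y0 => /(congr1 rsubmx); rewrite row_mxKr => ->.
  by rewrite linear0.
exists (block_mx r%:M 0 (r^-1 *: b^T) L').
rewrite [in LHS]ME tr_block_mx mulmx_block !trmx0 !mul0mx !mulmx0 !addr0 tr_scalar_mx.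
rewrite -scalar_mxM rr linearZ /= trmxK mul_scalar_mx scalerA divff// scale1r.
rewrite mul_mx_scalar [r *: _]scalerA divff// scale1r -scalemxAl -scalemxAr scalerA.
by rewrite -invrM ?unitfE// rr -L'E addrC subrK.
Qed.

(** * Elementary estimates *)

Lemma bernoulli_le (R : realFieldType) (t : R) n : 0 <= t <= 1 -> 1 - n%:R * t <= (1 - t) ^+ n.
Proof.
move=> /andP[t0 t1]; elim: n => [|n IHn]; first by rewrite mul0r subr0 expr0.
have n0 : 0 <= n%:R :> R by [].
have h : 0 <= 1 - t by rewrite subr_ge0.
rewrite exprS; apply: le_trans (ler_wpM2l h IHn).
rewrite -natr1; nra.
Qed.

Lemma central_bin_le n : ('C(n + n, n) <= 4 ^ n)%N.
Proof.
rewrite -[4%N]/((1 + 1) ^ 2)%N -expnM mul2n -addnn expnDn.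
under eq_bigr do rewrite !exp1n !muln1.
by rewrite (bigD1 (inord n)) //= inordK ?leq_addr// ltnS leq_addr.
Qed.

(** A weak Stirling bound: the product of [n] factors in [n.+1 .. n + n] is
    [n`! * 'C(n + n, n)]. *)
Lemma expn_le_fact_bin n : (n ^ n <= n`! * 4 ^ n)%N.
Proof.
apply: leq_trans (leq_mul (leqnn _) (central_bin_le n)).
rewrite mulnC bin_ffact ffact_prod -[in X in (X <= _)%N](card_ord n) -prod_nat_const.
apply: leq_prod => i _; rewrite -addnBA; last exact: ltnW.
by rewrite card_ord leq_addr.
Qed.

(** * Bases of maximal determinant *)

(** A set that no nonzero vector annihilates spans the space.  Rows are adjoined
    one at a time: a new row that does not vanish on some vector of the kernel of
    the previous ones is independent of them. *)
Lemma exists_basis (F : fieldType) n (V : set 'rV[F]_n) :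
  (forall x : 'rV_n, (forall q, V q -> q *m x^T = 0) -> x = 0) ->
  exists X : 'M[F]_n, X \in unitmx /\ forall i, V (row i X).
Proof.
move=> sepV.
suff H k : (k <= n)%N -> exists W : 'M[F]_(k, n), row_free W /\ forall i, V (row i W).
  by have [W [fW VW]] := H n (leqnn n); exists W; rewrite -row_free_unit.
elim: k => [_|k IHk kn].
  exists 0; split; last by case.
  by rewrite /row_free mxrank0.
have [W [fW VW]] := IHk (ltnW kn).
have /rowV0Pn[x /sub_kermxP xW x0] : kermx W^T != 0.
  by rewrite kermx_eq0 /row_free mxrank_tr (eqP fW) neq_ltn kn.
have [q Vq qx] : exists2 q, V q & q *m x^T != 0.
  apply: contrapT => nq; case/eqP: x0; apply: sepV => q Vq.
  by apply/eqP; apply: contrapT => /negP qx; apply: nq; exists q.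
rewrite -[k.+1]/(1 + k)%N; exists (col_mx q W); split.
  rewrite -kermx_eq0; apply: contrapT => /negP /rowV0Pn[y /sub_kermxP yqW /eqP]; apply.
  rewrite -[y]hsubmxK; rewrite -[y]hsubmxK mul_row_col in yqW.
  have Wx : W *m x^T = 0 by apply: trmx_inj; rewrite trmx_mul trmxK xW linear0.
  have y0 : lsubmx y = 0.
    have := congr1 (fun z => z *m x^T) yqW.
    rewrite mulmxDl mul0mx -!mulmxA Wx mulmx0 addr0.
    rewrite [q *m _]mx11_scalar mul_mx_scalar => /eqP.
    rewrite scaler_eq0 => /orP[|/eqP//] /eqP q0.
    by move/eqP: qx; rewrite [q *m _]mx11_scalar q0 -scalemx1 scale0r.
  move: yqW; rewrite y0 mul0mx add0r => yW.
  have -> : rsubmx y = 0 by apply: (row_free_inj fW); rewrite yW mul0mx.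
  by rewrite row_mx0.
move=> i; case: (split_ordP i) => j ->.
  by rewrite rowKu row_id.
by rewrite rowKd.
Qed.

Definition set_row (R : nmodType) m n (X : 'M[R]_(m, n)) i (q : 'rV[R]_n) : 'M[R]_(m, n) :=
  \matrix_k (if k == i then q else row k X).

(** Cramer's rule. *)
Lemma row_coord_det (F : fieldType) n (X : 'M[F]_n) (q : 'rV[F]_n) i :
  X \in unitmx -> (q *m invmx X) 0 i * \det X = \det (set_row X i q).
Proof.
move=> uX; rewrite /invmx uX -scalemxAr mxE mulrAC mulVf ?mul1r; last first.
  by rewrite -unitfE -unitmxE.
rewrite (expand_det_row _ i) mxE; apply: eq_bigr => j _.
rewrite !mxE eqxx; congr (_ * (_ * \det _)).
by apply/matrixP => k l; rewrite !mxE eq_sym (negbTE (neq_lift _ _)) !mxE.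
Qed.

Lemma row_coord_le1 (F : realFieldType) n (X : 'M[F]_n) (q : 'rV[F]_n) i :
  X \in unitmx -> `|\det (set_row X i q)| <= `|\det X| -> `|(q *m invmx X) 0 i| <= 1.
Proof.
move=> uX; rewrite -row_coord_det// normrM ger_pMl// normr_gt0.
by rewrite -unitfE -unitmxE.
Qed.

(** * Convex hulls with the origin *)

(** The combinations of [N] points of [V] with nonnegative weights of sum at
    most 1.  Sub-unit weights make this the convex hull of [V] and 0 once
    [N] is at least the dimension and [V] is nonempty, so that in
    [antipode_hull] only [m] points of [V] are needed, instead of the [m + 1] of
    Caratheodory's theorem. *)
Definition hull (R : numDomainType) N m (V : set 'rV[R]_m) : set 'rV[R]_m :=
  [set x | exists (a : 'rV[R]_N) (W : 'M[R]_(N, m)),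
    [/\ forall j, 0 <= a 0 j, \sum_j a 0 j <= 1, forall j, V (row j W) & x = a *m W]].

Section hull.
Variables (R : realFieldType) (m : nat) (V : set 'rV[R]_m).

Lemma hull_pad N : V !=set0 -> hull N V `<=` hull N.+1 V.
Proof.
move=> [v Vv] x [a [W [a0 a1 VW ->]]].
rewrite -[N.+1]/(1 + N)%N.
exists (row_mx (0 : 'rV[R]_1) a), (col_mx v W); split.
- by move=> i; case: (split_ordP i) => j ->; rewrite ?row_mxEl ?row_mxEr ?mxE.
- rewrite big_split_ord/= big1 ?add0r; last by move=> i _; rewrite row_mxEl mxE.
  by under eq_bigr do rewrite row_mxEr.
- by move=> i; case: (split_ordP i) => j ->; rewrite ?rowKu ?row_id ?rowKd.
- by rewrite mul_row_col mul0mx add0r.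
Qed.

(** One step of Caratheodory's argument.  More than [m] points admit a linear
    relation [y]; its sign is chosen so that its coefficients have a nonnegative
    sum, so that moving the weights along [- y] until one of them vanishes does
    not increase their sum. *)
Lemma hull_reduce N : (m <= N)%N -> hull N.+1 V `<=` hull N V.
Proof.
move=> mN x [a [W [a0 a1 VW ->]]].
have [y y0 [yW ys]] : exists2 y : 'rV_N.+1, y != 0 & y *m W = 0 /\ 0 <= \sum_j y 0 j.
  have /rowV0Pn[y /sub_kermxP yW y0] : kermx W != 0.
    by rewrite kermx_eq0 /row_free neq_ltn ltnS (leq_trans (rank_leq_col _)).
  case: (leP 0 (\sum_j y 0 j)) => ys; first by exists y.
  exists (- y); rewrite ?oppr_eq0//; split; first by rewrite mulNmx yW oppr0.
  by under eq_bigr do rewrite mxE; rewrite sumrN oppr_ge0 ltW.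
have [i0 yi0] : exists i, 0 < y 0 i.
  apply: contrapT => ny.
  have y_le0 i : y 0 i <= 0 by rewrite leNgt; apply/negP => yi; apply: ny; exists i.
  have /eqP : \sum_j - y 0 j = 0.
    by apply/eqP; rewrite sumrN oppr_eq0 eq_le ys sumr_le0.
  rewrite psumr_eq0; last by move=> i _; rewrite oppr_ge0.
  move/allP => h; move/eqP: y0; apply; apply/rowP => i; rewrite mxE.
  by apply/eqP; rewrite -oppr_eq0; apply: h; rewrite mem_index_enum.
have [i yi imin] := @arg_minP _ _ _ _ (fun i => 0 < y 0 i) (fun i => a 0 i / y 0 i) yi0.
pose t := a 0 i / y 0 i.
have t0 : 0 <= t by rewrite divr_ge0// ltW.
pose b := a - t *: y.
have b0 j : 0 <= b 0 j.
  rewrite !mxE subr_ge0; case: (ltP 0 (y 0 j)) => yj.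
    by rewrite -ler_pdivlMr//; exact: imin.
  by rewrite (le_trans _ (a0 j))// mulr_ge0_le0.
have bi : b 0 i = 0 by rewrite !mxE divfK ?subrr// gt_eqF.
exists (col' i b), (row' i W); split.
- by move=> j; rewrite mxE.
- apply: le_trans a1; under eq_bigr do rewrite mxE.
  have : \sum_j b 0 j <= \sum_j a 0 j.
    under eq_bigr do rewrite !mxE.
    by rewrite big_split/= sumrN -mulr_sumr gerDl oppr_le0 mulr_ge0.
  by rewrite (bigD1_ord i)//= bi add0r.
- by move=> j; have := VW (lift i j); congr V; apply/rowP => k; rewrite !mxE.
- transitivity (b *m W); first by rewrite mulmxBl -scalemxAl yW scaler0 subr0.
  apply/rowP => k; rewrite !mxE (bigD1_ord i)//= bi mul0r add0r.
  by apply: eq_bigr => j _; rewrite !mxE.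
Qed.

Lemma hull_caratheodory N : V !=set0 -> hull N V `<=` hull m V.
Proof.
move=> V0; have up k M : hull M V `<=` hull (k + M) V.
  elim: k => // k IHk; rewrite addSn.
  by apply: (subset_trans IHk); apply: hull_pad.
have down k : hull (k + m) V `<=` hull m V.
  elim: k => // k IHk; rewrite addSn.
  by apply: (subset_trans _ IHk); apply: hull_reduce; exact: leq_addl.
case: (leqP N m) => [/subnK Nm|/ltnW/subnK <-]; last exact: down.
by have := up (m - N)%N N; rewrite Nm.
Qed.

Lemma hull_convex : V !=set0 -> segment_closed (hull m V).
Proof.
move=> V0 _ _ t [a [W [a0 a1 VW ->]]] [b [Z [b0 b1 VZ ->]]] /andP[t0 t1].
have t1' : 0 <= 1 - t by rewrite subr_ge0.
apply: (hull_caratheodory (N := m + m) V0).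
exists (row_mx (t *: a) ((1 - t) *: b)), (col_mx W Z); split.
- by move=> i; case: (split_ordP i) => j ->; rewrite ?row_mxEl ?row_mxEr mxE mulr_ge0.
- rewrite big_split_ord/=.
  under eq_bigr do rewrite row_mxEl mxE.
  under [X in _ + X]eq_bigr do rewrite row_mxEr mxE.
  rewrite -!mulr_sumr; have : t * \sum_j a 0 j <= t * 1 by rewrite ler_wpM2l.
  have : (1 - t) * \sum_j b 0 j <= (1 - t) * 1 by rewrite ler_wpM2l.
  by lra.
- by move=> i; case: (split_ordP i) => j ->; rewrite ?rowKu ?rowKd.
- by rewrite mul_row_col !scalemxAl.
Qed.

Lemma sub_hull N : (0 < N)%N -> V `<=` hull N V.
Proof.
case: N => // N _ v Vv; exists (delta_mx 0 0), (\matrix_i v); split.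
- by move=> j; rewrite mxE.
- rewrite (bigD1 ord0)//= mxE !eqxx big1 ?addr0// => i i0.
  by rewrite mxE (negbTE i0) andbF.
- by move=> j; rewrite rowK.
- by rewrite -rowE rowK.
Qed.

End hull.

(** * Continuity and compactness *)

Lemma mx_cvg (R : numFieldType) T (F : set_system T) {FF : Filter F} m n
  (f : T -> 'M[R]_(m, n)) (l : 'M[R]_(m, n)) :
  (forall i j, f x i j @[x --> F] --> l i j) -> f @ F --> l.
Proof.
move=> fl A [P lP PA]; rewrite /nbhs /=.
have H : F (fun x => forall ij : 'I_m * 'I_n, P ij.1 ij.2 (f x ij.1 ij.2)).
  by apply: filter_forall => -[i j]; exact: fl.
by apply: filterS H => x Px; apply: PA => i j; exact: (Px (i, j)).
Qed.

Section continuity.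
Variables (R : numFieldType) (T : topologicalType).

Lemma continuous_sumr (I : Type) (r : seq I) (P : pred I) (f : I -> T -> R) :
  (forall i, P i -> continuous (f i)) -> continuous (fun x => \sum_(i <- r | P i) f i x).
Proof. by apply: continuous_big; exact: add_continuous. Qed.

Lemma continuous_prodr (I : Type) (r : seq I) (P : pred I) (f : I -> T -> R) :
  (forall i, P i -> continuous (f i)) -> continuous (fun x => \prod_(i <- r | P i) f i x).
Proof. by apply: continuous_big; exact: mul_continuous. Qed.

Lemma continuous_det n (f : T -> 'M[R]_n) :
  (forall i j, continuous (fun x => f x i j)) -> continuous (fun x => \det (f x)).
Proof.
move=> cf; apply: continuous_sumr => s _ x; apply: cvgM; first exact: cvg_cst.
by apply: continuous_prodr => i _; exact: cf.
Qed.

Lemma continuous_mulmx p q r (f : T -> 'M[R]_(p, q)) (g : T -> 'M[R]_(q, r)) :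
  (forall i j, continuous (fun x => f x i j)) ->
  (forall i j, continuous (fun x => g x i j)) ->
  forall i j, continuous (fun x => (f x *m g x) i j).
Proof.
move=> cf cg i j; under [X in continuous X]eq_fun do rewrite mxE.
by apply: continuous_sumr => k _ x; apply: cvgM; [exact: cf|exact: cg].
Qed.

Lemma continuous_mx p q (f : T -> 'M[R]_(p, q)) :
  (forall i j, continuous (fun x => f x i j)) -> continuous f.
Proof. by move=> cf x; apply: mx_cvg => i j; exact: cf. Qed.

End continuity.

Lemma continuous_dot (R : numFieldType) (T : topologicalType) n (f g : T -> 'rV[R]_n) :
  (forall i j, continuous (fun x => f x i j)) ->
  (forall i j, continuous (fun x => g x i j)) -> continuous (fun x => dot (f x) (g x)).
Proof.
move=> cf cg; apply: continuous_mulmx => // i j.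
by under [X in continuous X]eq_fun do rewrite mxE; exact: cg.
Qed.

Lemma compact_rows (R : realType) m n (V : set 'rV[R]_n) :
  compact V -> compact [set X : 'M[R]_(m, n) | forall i, V (row i X)].
Proof.
move=> cV.
pose f (v : 'rV['rV[R]_n]_m) : 'M[R]_(m, n) := \matrix_i v 0 i.
have -> : [set X : 'M[R]_(m, n) | forall i, V (row i X)] =
    f @` [set v : 'rV['rV[R]_n]_m | forall i, V (v ord0 i)].
  apply/seteqP; split => [X VX|_ [v Vv <-] i]; last by rewrite rowK.
  exists (\row_i row i X); first by move=> i; rewrite mxE.
  by apply/row_matrixP => i; rewrite rowK mxE.
apply: continuous_compact; last exact: (@rV_compact _ _ (fun _ => V)).
apply: continuous_subspaceT; apply: continuous_mx => i j.
under [X in continuous X]eq_fun do rewrite mxE.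
move=> v; apply: (@continuous_comp _ _ _ (fun v : 'rV['rV[R]_n]_m => v 0 i) (fun y : 'rV[R]_n => y 0 j)).
  move=> A vA; exists (fun k l => if l == i then A else setT).
    by move=> k l; rewrite ord1; case: eqP => [->//|_]; exact: filterT.
  by move=> w /(_ 0 i); rewrite eqxx.
exact: coord_continuous.
Qed.

Lemma compact_coord_bounded (R : realType) n (A : set 'rV[R]_n) : compact A ->
  exists M : R, forall x, A x -> forall j, `|x 0 j| <= M.
Proof.
move=> /compact_bounded[M [_ MA]]; exists (M + 1) => x Ax j.
apply: le_trans (MA (M + 1) _ x Ax); last by rewrite ltrDl.
by rewrite [leRHS]/Num.norm /= mx_normrE; apply/bigmax_geP; right => /=; exists (0, j).
Qed.

Lemma closed_translate (R : realType) n (A : set 'rV[R]_n) p : closed A -> closed [set x | A (p + x)].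
Proof.
move=> cA; apply: (@closed_comp _ _ (fun x => p + x) A); last exact: cA.
by move=> x _; apply: continuousD; [exact: cst_continuous|exact: cvg_id].
Qed.

Lemma hull_compact (R : realType) N m (V : set 'rV[R]_m) :
  compact V -> compact (hull N V).
Proof.
move=> cV.
pose S := [set a : 'rV[R]_N | (forall j, 0 <= a 0 j) /\ \sum_j a 0 j <= 1].
have cS : compact S.
  pose B := [set a : 'rV[R]_N | forall j, `[0, 1]%classic (a ord0 j)].
  have cB : compact B.
    have h := @rV_compact R N (fun _ => `[0, 1]%classic) (fun _ => @segment_compact R 0 1).
    exact: h.
  have -> : S = B `&` [set a : 'rV[R]_N | \sum_j a 0 j <= 1].
    apply/seteqP; split => a [a0 a1]; split => //.
      move=> j; rewrite /= in_itv/= a0 (le_trans _ a1)// (bigD1 j)//= lerDl.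
      by rewrite sumr_ge0.
    by move=> j; have := a0 j; rewrite /= in_itv/= => /andP[].
  apply: compact_closedI => //.
  apply: (@closed_comp _ _ (fun a : 'rV[R]_N => \sum_j a 0 j) [set r | r <= 1]); last exact: closed_le.
  by move=> a _; apply: continuous_sumr => j _; exact: coord_continuous.
have -> : hull N V = (fun aW : 'rV[R]_N * 'M[R]_(N, m) => aW.1 *m aW.2) @`
    (S `*` [set W : 'M[R]_(N, m) | forall i, V (row i W)]).
  apply/seteqP; split => [x [a [W [a0 a1 VW ->]]]|_ [[a W] [[a0 a1] VW]] <-].
    by exists (a, W).
  by exists a, W.
apply: continuous_compact; last exact: compact_setX cS (compact_rows cV).
apply: continuous_subspaceT; apply: continuous_mx; apply: continuous_mulmx => i j x.
  by apply: (@continuous_comp _ _ _ fst (fun a : 'rV[R]_N => a i j)); [exact: cvg_fst|exact: coord_continuous].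
by apply: (@continuous_comp _ _ _ snd (fun a : 'M[R]_(N, m) => a i j)); [exact: cvg_snd|exact: coord_continuous].
Qed.

(** For a basis of maximal determinant, replacing one row by a point [q] of [V]
    multiplies the determinant by a coordinate of [q]; all coordinates are
    therefore at most 1 in absolute value. *)
Lemma max_det_basis (R : realType) n (V : set 'rV[R]_n) : compact V ->
  (forall x : 'rV_n, (forall q, V q -> q *m x^T = 0) -> x = 0) ->
  exists X : 'M[R]_n, [/\ X \in unitmx, forall i, V (row i X),
    forall Y : 'M[R]_n, (forall i, V (row i Y)) -> `|\det Y| <= `|\det X|
    & forall q i, V q -> `|(q *m invmx X) 0 i| <= 1].
Proof.
move=> cV sepV; have [X0 [uX0 VX0]] := exists_basis sepV.
have [||X] := @compact_EVT_max _ R (fun X : 'M[R]_n => `|\det X|) _ _ (compact_rows (m := n) cV).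
- by exists X0.
- apply: continuous_subspaceT => X.
  apply: (@continuous_comp _ _ _ (fun X : 'M[R]_n => \det X) Num.norm).
    by apply: continuous_det => i j; exact: coord_continuous.
  exact: norm_continuous.
rewrite inE => VX Xmax.
have maxX (Y : 'M[R]_n) : (forall i, V (row i Y)) -> `|\det Y| <= `|\det X|.
  by move=> VY; apply: Xmax; rewrite inE.
have uX : X \in unitmx.
  rewrite unitmxE unitfE -normr_gt0 (lt_le_trans _ (maxX _ VX0))// normr_gt0.
  by rewrite -unitfE -unitmxE.
exists X; split => // q i Vq; apply: row_coord_le1 => //; apply: maxX => k.
by rewrite rowK; case: eqP.
Qed.

(** Strict separation of [x] from a closed convex set containing 0, normalised
    so that the separating functional lies in the polar of that set.  It is
    proportional to [x - z], where [z] is the point of [C] nearest to [x]. *)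
Lemma separation (R : realType) n (C : set 'rV[R]_n) (x : 'rV[R]_n) :
  closed C -> segment_closed C ->
  C 0 -> ~ C x -> exists q, (forall y, C y -> dot q y <= 1) /\ 1 < dot q x.
Proof.
move=> clC cC C0 Cx; pose D := dot x x; pose f (y : 'rV[R]_n) := dot (y - x) (y - x).
have cf : continuous f.
  suff h i j : continuous (fun y : 'rV[R]_n => (y - x) i j) by exact: continuous_dot.
  have -> : (fun y : 'rV[R]_n => (y - x) i j) = (fun y => y i j + cst (- x i j) y).
    by apply/funext => y; rewrite !mxE.
  by move=> y; apply: continuousD; [exact: coord_continuous|exact: cst_continuous].
have D0 : 0 <= D := dot_ge0 x.
have f0 : f 0 = D by rewrite /f add0r dotNl dotNr opprK.
pose B := C `&` [set y | f y <= D].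
have cB : compact B.
  pose Q := [set y : 'rV[R]_n | forall j, `[x ord0 j - (D + 1), x ord0 j + (D + 1)]%classic (y ord0 j)].
  have cQ : compact Q.
    have h := @rV_compact R n (fun j => `[x ord0 j - (D + 1), x ord0 j + (D + 1)]%classic)
      (fun j => @segment_compact R _ _).
    exact: h.
  apply: subclosed_compact cQ _.
    apply: closedI => //.
    apply: (@closed_comp _ _ f [set r | r <= D]); last exact: closed_le.
    by move=> y _; exact: cf.
  move=> y [_ /= fy] j; have := le_trans (dot_coord (y - x) j) fy.
  rewrite !mxE /= in_itv/= => h.
  apply/andP; split; nra.
(* Only points at least as close to x as the origin compete, and these form a
   compact set. *)
have [||z] := @compact_EVT_min _ R f B _ cB.
- by exists 0; split => //=; rewrite f0.
- exact: continuous_subspaceT.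
rewrite inE => -[Cz /= fzD] zmin.
have fz y : C y -> f z <= f y.
  move=> Cy; case: (leP (f y) D) => h; first by apply: zmin; rewrite inE.
  by rewrite (le_trans fzD)// ltW.
(* The first-order condition at z, from the step length A / (A + E + 1). *)
have var y : C y -> dot (x - z) (y - z) <= 0.
  move=> Cy; rewrite leNgt; apply/negP => A0.
  set A := dot _ _ in A0; pose E := dot (y - z) (y - z).
  have E0 : 0 <= E := dot_ge0 _.
  pose t := A / (A + E + 1).
  have s0 : 0 < A + E + 1 by nra.
  have t0 : 0 < t by rewrite divr_gt0.
  have t1 : t <= 1 by rewrite ler_pdivrMr// mul1r; nra.
  have := fz _ (cC y z t Cy Cz _); rewrite (ltW t0) t1 => /(_ isT).
  have -> : t *: y + (1 - t) *: z = z + t *: (y - z).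
    by rewrite scalerBl scale1r scalerBr addrCA addrA.
  have -> : f (z + t *: (y - z)) = f z + t * (t * E - 2 * A).
    rewrite /f /E /A (_ : z + _ - x = (z - x) + t *: (y - z)); last by rewrite addrAC.
    have -> : x - z = - (z - x) by rewrite opprB.
    move: (z - x) (y - z) => w v.
    by rewrite dotNl !dotDl !dotDr !dotZl !dotZr (dotC v); ring.
  rewrite -subr_ge0 addrC addKr pmulr_rge0// subr_ge0 => h.
  have : t * E <= A.
    rewrite /t mulrAC ler_pdivrMr//; nra.
  by nra.
have xz : 0 < dot (x - z) (x - z).
  by apply: dot_gt0; rewrite subr_eq0; apply: contra_notN Cx => /eqP ->.
pose b := dot (x - z) z; have b0 : 0 <= b.
  by have := var 0 C0; rewrite sub0r dotNr oppr_le0.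
have bx : b < dot (x - z) x by rewrite -subr_gt0 /b -dotNr -dotDr.
pose g := (b + dot (x - z) x) / 2.
have g0 : 0 < g by rewrite /g; lra.
exists (g^-1 *: (x - z)); split => [y Cy|]; rewrite dotZl mulrC.
  rewrite ler_pdivrMr// mul1r.
  have := var y Cy; rewrite dotDr dotNr -/b subr_le0 => h.
  by apply: le_trans h _; rewrite /g; lra.
by rewrite ltr_pdivlMr// mul1r /g; lra.
Qed.

Lemma interior_cube (R : realType) n (C : set 'rV[R]_n) x0 : C° x0 ->
  exists2 e : R, 0 < e & forall h : 'rV[R]_n, (forall j, `|h 0 j| <= e) -> C (x0 + h).
Proof.
move=> /nbhs_ballP[e /= e0 be]; exists (e / 2); first by rewrite divr_gt0.
move=> h he; apply: be; split => // i j; rewrite ord1 -ball_normE /= !mxE.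
rewrite opprD addNKr normrN; apply: le_lt_trans (he j) _.
by rewrite ltr_pdivrMr// ltr_pMr// ltr1n.
Qed.

(** The centre [p] is the centroid of an inscribed simplex of maximal volume.
    Lifting [x] to [(1, x)] turns simplices into bases and barycentric coordinates
    into coordinates, so [max_det_basis] applies: the barycentric coordinates [la]
    of any point of [K] are at most 1, and the antipode of that point has the
    nonnegative barycentric coordinates [(1 - la) / n].  A cube around [p] arises as
    a convex combination of a cube in [K] and the antipode of its centre. *)
Lemma minkowski_center (R : realType) n (K : set 'rV[R]_n) : (0 < n)%N ->
  compact K -> segment_closed K -> K° !=set0 ->
  exists p : 'rV[R]_n, (exists2 r : R, 0 < r & forall x : 'rV[R]_n, (forall j, `|x 0 j| <= r) -> K (p + x)) /\
    forall x : 'rV[R]_n, K (p + x) -> K (p - n%:R^-1 *: x).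
Proof.
move=> n0 cK sK [x0 /interior_cube[e e0 Ke]].
have n0R : 0 < n%:R :> R by rewrite ltr0n.
have Kx0 : K x0 by rewrite -[x0]addr0; apply: Ke => j; rewrite mxE normr0 ltW.
pose lift1 (x : 'rV[R]_n) : 'rV[R]_(1 + n) := row_mx 1%:M x.
pose V := lift1 @` K.
have cV : compact V.
  apply: continuous_compact => //; apply: continuous_subspaceT; apply: continuous_mx => i j.
  case: (split_ordP j) => k ->.
    by under [X in continuous X]eq_fun do rewrite /lift1 row_mxEl; exact: cst_continuous.
  by under [X in continuous X]eq_fun do rewrite /lift1 row_mxEr; exact: coord_continuous.
have sepV (z : 'rV[R]_(1 + n)) : (forall q, V q -> q *m z^T = 0) -> z = 0.
  rewrite -[z]hsubmxK; set a := lsubmx z; set y := rsubmx z => h.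
  have hK x : K x -> a 0 0 + dot x y = 0.
    move=> Kx; have := h (lift1 x) (ex_intro2 _ _ x Kx erefl).
    rewrite /lift1 tr_row_mx mul_row_col mul1mx => /matrixP /(_ 0 0) E.
    transitivity ((a^T + x *m y^T) 0 0); first by rewrite [RHS]mxE; congr (_ + _); rewrite [RHS]mxE.
    by rewrite E mxE.
  have y0 : y = 0.
    apply/rowP => j; rewrite [RHS]mxE.
    have := hK (x0 + e *: delta_mx 0 j) _; rewrite dotDl addrA hK// add0r dotZl.
    rewrite dotC dot_delta.
    have K' : K (x0 + e *: delta_mx 0 j).
      by apply: Ke => k; rewrite (le_trans (scale_delta_le _ _ _))// gtr0_norm.
    by move=> /(_ K') /eqP; rewrite mulf_eq0 gt_eqF//= => /eqP.
  have a0 : a = 0.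
    by apply/matrixP => i j; rewrite !ord1 [RHS]mxE; have := hK _ Kx0; rewrite y0 dot0r addr0.
  by rewrite a0 y0 row_mx0.
have [X [uX VX _ X1]] := max_det_basis cV sepV.
pose Z := rsubmx X.
have XE : X = row_mx (const_mx 1) Z.
  rewrite -[LHS]hsubmxK; congr row_mx; apply/matrixP => i j.
  have [x _ /rowP /(_ (lshift n j))] := VX i.
  by rewrite /lift1 row_mxEl !mxE ord1 eqxx => <-.
have KZ i : K (row i Z).
  have [x Kx xE] := VX i; suff -> : row i Z = x by [].
  apply/rowP => j; have /rowP /(_ (rshift 1 j)) := xE.
  by rewrite /lift1 row_mxEr !mxE => ->.
have comb (mu : 'rV[R]_(1 + n)) : (forall j, 0 <= mu 0 j) -> \sum_j mu 0 j = 1 -> K (mu *m Z).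
  by move=> mu0 mu1; apply: convex_comb.
have N0 : 0 < (1 + n)%:R :> R by rewrite ltr0n.
have N1 : 1 + n%:R != 0 :> R by rewrite gt_eqF// -[1]/(1%:R) -natrD.
pose p := (const_mx (1 + n)%:R^-1 : 'rV[R]_(1 + n)) *m Z.
have anti x : K (p + x) -> K (p - n%:R^-1 *: x).
  move=> Kx; pose la := lift1 (p + x) *m invmx X.
  have la1 i : la 0 i <= 1.
    apply: le_trans (ler_norm _) _; apply: X1; exists (p + x) => //.
  have : la *m X = lift1 (p + x) by rewrite mulmxKV.
  rewrite XE mul_mx_row /lift1 => /eq_row_mx [laS laZ].
  have sla : \sum_j la 0 j = 1.
    have /matrixP /(_ 0 0) := laS; rewrite mxE [in RHS]mxE eqxx => E.
    by rewrite -[RHS]E; apply: eq_bigr => j _; rewrite [const_mx _ _ _]mxE mulr1.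
  pose mu : 'rV[R]_(1 + n) := n%:R^-1 *: (const_mx 1 - la).
  have -> : p - n%:R^-1 *: x = mu *m Z.
    have -> : x = la *m Z - p by rewrite laZ addrC addKr.
    rewrite /mu -scalemxAl mulmxBl !scalerBr opprB addrA; congr (_ - _).
    have -> : (const_mx 1 : 'rV[R]_(1 + n)) *m Z = (1 + n)%:R *: p.
      rewrite /p scalemxAl; congr (_ *m _).
      by apply/rowP => j; rewrite !mxE divff// gt_eqF.
    rewrite scalerA -[X in X + _ = _]scale1r -scalerDl; congr (_ *: _).
    by rewrite natrD; field; rewrite gt_eqF.
  have muE j : mu 0 j = n%:R^-1 * (1 - la 0 j).
    by rewrite /mu mxE [X in _ * X]mxE [const_mx _ _ _]mxE [X in _ + X]mxE.
  apply: comb => [j|].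
    by rewrite muE; apply: mulr_ge0; rewrite ?subr_ge0 ?invr_ge0//; exact: ltW.
  under eq_bigr do rewrite muE.
  rewrite -mulr_sumr big_split/= sumrN sla sumr_const card_ord natrD.
  by field; rewrite gt_eqF.
exists p; split => //.
exists (e / (1 + n)%:R); first by rewrite divr_gt0.
move=> x xe; pose y := x0 - p.
have Ky : K (p + y) by rewrite /y addrC subrK.
pose h := (1 + n)%:R *: x.
have Kh : K (p + (y + h)).
  rewrite addrA (addrC p) subrK; apply: Ke => j.
  by rewrite mxE normrM (gtr0_norm N0) mulrC -ler_pdivlMr.
clearbody y.
have -> : p + x = (1 + n)%:R^-1 *: (p + (y + h)) + (1 - (1 + n)%:R^-1) *: (p - n%:R^-1 *: y).
  have -> : 1 - (1 + n)%:R^-1 = n%:R / (1 + n)%:R :> R.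
    by rewrite natrD; field.
  rewrite /h !scalerDr scalerN !scalerA mulVf ?gt_eqF// scale1r.
  have -> : n%:R / (1 + n)%:R * n%:R^-1 = (1 + n)%:R^-1 :> R.
    by rewrite mulrAC divff ?gt_eqF// mul1r.
  rewrite addrACA -scalerDl [X in _ = _ + X]addrAC subrr add0r; congr (_ + _).
  by rewrite -[LHS]scale1r; congr (_ *: _); rewrite natrD; field.
by apply: sK => //; [exact: anti|rewrite invr_ge0 ltW//= invf_le1// natrD lerDl].
Qed.

(** * A large parallelepiped in the polar body *)

(** A maximiser of [\det (gram c W)] over all weighted families from [V] is the
    dual description of the largest ellipsoid centred at 0 in the polar of [V].
    A maximum up to the factor 2/3 is enough for the volume estimate, and it
    exists without bounding the number [N] of rows: [det_gram_le] bounds the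
    determinants. *)
Lemma near_max_gram (R : realType) n (V : set 'rV[R]_n) (X : 'M[R]_n) (t : R) :
  (0 < n)%N -> X \in unitmx -> (forall i, V (row i X)) ->
  (forall Y : 'M[R]_n, (forall i, V (row i Y)) -> `|\det Y| <= `|\det X|) -> 0 <= t <= 1 ->
  exists N (c : 'rV[R]_N) (W : 'M[R]_(N, n)),
    [/\ forall j, 0 <= c 0 j, 0 < \det (gram c W), n`!%:R * \det (gram c W) <= \det X ^+ 2
      & forall q, V q ->
          \det ((1 - t) *: gram c W + t *: (q^T *m q)) <= 3 / 2 * \det (gram c W)].
Proof.
move=> n0 uX VX maxX /andP[t0 t1].
have n0R : 0 < n%:R :> R by rewrite ltr0n.
have DX0 : 0 < \det X ^+ 2 by rewrite exprn_even_gt0// -unitfE -unitmxE.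
pose S : set R := [set s | exists N (c : 'rV[R]_N) (W : 'M[R]_(N, n)),
  [/\ forall j, 0 <= c 0 j, \sum_j c 0 j <= 1, forall j, V (row j W) & s = \det (gram c W)]].
have Sle s : S s -> n`!%:R * s <= \det X ^+ 2.
  move=> [N [c [W [c0 c1 VW ->]]]].
  rewrite -[\det X ^+ 2]real_normK ?num_real//; apply: det_gram_le => // f.
  by apply: maxX => i; have := VW (f i); congr V; apply/rowP => j; rewrite !mxE.
have fact0 : 0 < n`!%:R :> R by rewrite ltr0n fact_gt0.
pose s0 := n%:R ^- n * \det X ^+ 2.
have Ss0 : S s0.
  exists n, (const_mx n%:R^-1), X; split => //.
  - by move=> j; rewrite mxE invr_ge0 ltW.
  - under eq_bigr do rewrite mxE.
    by rewrite sumr_const card_ord -[X in X <= _]mulr_natl divff ?gt_eqF.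
  - rewrite /s0 /gram diag_const_mx mul_mx_scalar -scalemxAl detZ det_mulmx det_tr expr2.
    by rewrite exprVn.
have s0_gt0 : 0 < s0 by rewrite mulr_gt0// invr_gt0 exprn_gt0.
have supS : has_sup S.
  split; first by exists s0.
  exists (\det X ^+ 2 / n`!%:R) => s /Sle; rewrite ler_pdivlMr//.
  by rewrite mulrC.
have sup_gt0 : 0 < sup S by apply: lt_le_trans s0_gt0 _; apply: ub_le_sup => //; case: supS.
have [|_ [N [c [W [c0 c1 VW ->]]]] sM] := @sup_adherent _ S (sup S / 3) _ supS.
  by rewrite divr_gt0.
exists N, c, W; split => //; first by lra.
  by apply: Sle; exists N, c, W.
move=> q Vq; suff Sq : S (\det ((1 - t) *: gram c W + t *: (q^T *m q))).
  by have := ub_le_sup (proj2 supS) Sq; lra.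
rewrite -gram_adjoin; exists (N + 1)%N, (row_mx ((1 - t) *: c) t%:M), (col_mx W q); split => //.
- move=> j; case: (split_ordP j) => k ->.
    by rewrite row_mxEl mxE mulr_ge0// subr_ge0.
  by rewrite row_mxEr ord1 !mxE eqxx mulr1n.
- rewrite big_split_ord/= big_ord1 row_mxEr mxE eqxx mulr1n.
  under eq_bigr do rewrite row_mxEl mxE.
  by rewrite -mulr_sumr; nra.
- move=> j; case: (split_ordP j) => k ->; first by rewrite rowKu.
  by rewrite rowKd ord1 row_id.
Qed.

(** At an exact maximum, differentiating [\det] in the direction [q^T *m q]
    bounds [q *m invmx M *m q^T] by [n] (Kiefer-Wolfowitz).  A single finite
    step [t = (4 * n)^-1] loses a factor 4 and tolerates the factor [3 / 2]. *)
Lemma near_max_quad (R : realFieldType) n (M : 'M[R]_n) (q : 'rV[R]_n) :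
  let t := (4 * n%:R)^-1 in let s := (q *m invmx M *m q^T) 0 0 in
  (0 < n)%N -> 0 < \det M -> 0 <= s ->
  \det ((1 - t) *: M + t *: (q^T *m q)) <= 3 / 2 * \det M -> s <= 4 * n%:R.
Proof.
move=> t s n0 M0 s0.
have n0R : 0 < n%:R :> R by rewrite ltr0n.
have n1R : 1 <= n%:R :> R by rewrite ler1n.
have t0 : 0 < t by rewrite invr_gt0 mulr_gt0.
have nt : n%:R * t = 4^-1.
  by rewrite /t invfM mulrCA divff ?mulr1// gt_eqF.
have t14 : t <= 4^-1 by rewrite -nt ler_peMl// ltW.
have t1 : 0 < 1 - t by lra.
have uM : M \in unitmx by rewrite unitmxE unitfE gt_eqF.
have -> : (1 - t) *: M + t *: (q^T *m q) = (1 - t) *: (M + (((1 - t)^-1 * t) *: q^T) *m q).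
  by rewrite scalerDr -scalemxAl scalerA mulrA divff ?mul1r ?gt_eqF.
rewrite detZ det_rank1_update// -scalemxAr mxE -/s.
have h : 1 - 4^-1 <= (1 - t) ^+ n.
  by rewrite -nt; apply: bernoulli_le; apply/andP; split; lra.
set e := (1 - t) ^+ n in h *; set r := _^-1 * t => hle.
have rs0 : 0 <= r * s.
  by apply: mulr_ge0 => //; rewrite /r mulr_ge0 ?invr_ge0//; exact: ltW.
have : r * s <= 1.
  rewrite leNgt; apply/negP => h1.
  have : 3 / 2 * \det M < e * (\det M * (1 + r * s)).
    have : 3/4 * \det M <= e * \det M by apply: ler_wpM2r; [exact: ltW|lra].
    nra.
  lra.
rewrite -(ler_pM2l t1) /r !mulrA divff ?gt_eqF// mul1r mulr1 => h2.
rewrite -(@ler_pM2l _ t)//; apply: (le_trans h2).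
rewrite (_ : t * _ = 1); first by lra.
by rewrite mulVf// gt_eqF// mulr_gt0.
Qed.

(** The ellipsoid given by a nearly maximal Gram matrix [L *m L^T] lies in the
    polar of [V]; its inscribed cube in the coordinates [y *m L] is used in its
    place, because the volume of a parallelepiped is elementary and only an
    exponential factor is lost.  The gain of [n`!] over the parallelepiped
    spanned by [X] itself is what lowers the volume exponent from [2 * n] to
    [3 * n / 2]. *)
Lemma dual_cube (R : realType) n (V : set 'rV[R]_n) (X : 'M[R]_n) :
  (0 < n)%N -> X \in unitmx -> (forall i, V (row i X)) ->
  (forall Y : 'M[R]_n, (forall i, V (row i Y)) -> `|\det Y| <= `|\det X|) ->
  exists L : 'M[R]_n, [/\ L \in unitmx, n`!%:R * \det L ^+ 2 <= \det X ^+ 2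
    & forall y q, (forall j, `|(y *m L) 0 j| <= (2 * n%:R)^-1) -> V q -> dot q y <= 1].
Proof.
move=> n0 uX VX maxX.
have n0R : 0 < n%:R :> R by rewrite ltr0n.
have n1R : 1 <= n%:R :> R by rewrite ler1n.
have t01 : 0 <= (4 * n%:R : R)^-1 <= 1.
  by rewrite invr_ge0 mulr_ge0//= invf_le1 ?mulr_gt0//; lra.
have [N [c [W [c0 M0 MX Mq]]]] := near_max_gram n0 uX VX maxX t01.
set M := gram c W in M0 MX Mq.
have uM : M \in unitmx by rewrite unitmxE unitfE gt_eqF.
have [L ML] := cholesky (gram_sym c W) (fun x => gram_posdef c0 uM).
rewrite -/M in ML.
have detL : \det M = \det L ^+ 2 by rewrite ML det_mulmx det_tr expr2.
have uL : L \in unitmx.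
  by rewrite unitmxE unitfE; apply: contraTneq M0 => dL; rewrite detL dL expr0n/= ltxx.
exists L; split => //; first by rewrite -detL.
move=> y q yL Vq.
pose w := q *m (invmx L)^T; pose z := y *m L.
have invM : invmx M = (invmx L)^T *m invmx L.
  apply: (can_inj (mulmxK uM)).
  rewrite mulVmx// ML -mulmxA (mulmxA (invmx L)) mulVmx// mul1mx -trmx_mul.
  by rewrite mulmxV// trmx1.
have ww : dot w w = (q *m invmx M *m q^T) 0 0.
  by rewrite invM /dot /w trmx_mul trmxK !mulmxA.
have w4n : dot w w <= 4 * n%:R.
  by rewrite ww; apply: near_max_quad => //; [rewrite -ww dot_ge0|exact: Mq].
have zz : dot z z <= (4 * n%:R)^-1.
  rewrite dotE (_ : (4 * n%:R)^-1 = \sum_(j < n) (2 * n%:R)^-1 ^+ 2).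
    apply: ler_sum => j _; rewrite -expr2 -real_normK ?num_real//.
    by apply: lerXn2r; rewrite ?nnegrE//; exact: le_trans (yL j).
  rewrite sumr_const card_ord -mulr_natl; field.
  by rewrite gt_eqF.
have -> : dot q y = dot w z.
  by rewrite /dot /w /z trmx_mul -mulmxA (mulmxA (_^T)) -trmx_mul mulmxV// trmx1 mul1mx.
(* Cauchy-Schwarz in the additive form 2 a b <= a ^ 2 + b ^ 2, weighted by the
   two bounds w4n and zz. *)
have := dot_ge0 (w - (4 * n%:R) *: z).
rewrite dotDl !dotDr !dotNl !dotNr !dotZl !dotZr (dotC z w) opprK => h.
have : (4 * n%:R) * dot z z <= 1.
  by rewrite mulrC -ler_pdivlMr ?mul1r// mulr_gt0.
nra.
Qed.

(** * Selection of the polar points *)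

Section selection.
Variables (R : realType) (n m : nat) (P : 'I_m -> set 'rV[R]_n).
Hypothesis n0 : (0 < n)%N.
Hypothesis clP : forall i, closed (P i).
Hypothesis scP : forall i, segment_closed (P i).
Variables (r : R).
Hypothesis r0 : 0 < r.
Hypothesis cubeP : forall i (x : 'rV[R]_n), (forall j, `|x 0 j| <= r) -> P i x.

Definition polars : set 'rV[R]_n := [set q | exists i, forall x, P i x -> dot q x <= 1].

Let P0 i : P i 0.
Proof. by apply: cubeP => j; rewrite mxE normr0 ltW. Qed.

(** Bipolarity: it suffices to separate [x] from the single set [P i]. *)
Lemma mem_of_polars x i : (forall q, polars q -> dot q x <= 1) -> P i x.
Proof.
move=> h; apply: contrapT => nPx.
have [q [qP]] := separation (@clP i) (@scP i) (@P0 i) nPx.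
by apply/negP; rewrite -leNgt; apply: h; exists i.
Qed.

(** A polar of a set containing the cube of half-edge [r] lies in the cube of
    half-edge [r^-1]. *)
Lemma polars_compact : compact polars.
Proof.
pose Q := [set q : 'rV[R]_n | forall j, `[- r^-1, r^-1]%classic (q ord0 j)].
have cQ : compact Q.
  exact: (@rV_compact R n (fun j => `[- r^-1, r^-1]%classic) (fun j => @segment_compact R _ _)).
apply: (subclosed_compact _ cQ).
  have -> : polars = \bigcup_(i in [set: 'I_m]) \bigcap_(x in P i) [set q | dot q x <= 1].
    apply/seteqP; split => [q [i h]|q [i _ h]]; exists i => //.
  apply: closed_bigcup; first exact: finite_finset.
  move=> i _; apply: closed_bigI => x _.
  apply: (@closed_comp _ _ (fun q : 'rV[R]_n => dot q x) [set s | s <= 1]); last exact: closed_le.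
  move=> q _; apply: continuous_dot => a b; last exact: cst_continuous.
  exact: coord_continuous.
move=> q [i qP] j /=.
have H (s : R) : `|s| <= r -> s * q 0 j <= 1.
  move=> sr; rewrite -dot_delta -dotZr.
  by apply: qP; apply: cubeP => k; apply: le_trans sr; exact: scale_delta_le.
have h1 := H r; have h2 := H (- r); rewrite normrN gtr0_norm// in h1 h2.
rewrite in_itv/= lerNl -[r^-1]mul1r !ler_pdivlMr// mulrC (mulrC _ r).
by rewrite h1// mulrN -mulNr h2.
Qed.

Variable M : R.
Hypothesis bndP : forall x : 'rV[R]_n, (forall i, P i x) -> forall j, `|x 0 j| <= M.

(** A vector annihilated by all polar points spans a line contained in the bounded
    intersection. *)
Lemma polars_separate (x : 'rV[R]_n) : (forall q, polars q -> q *m x^T = 0) -> x = 0.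
Proof.
move=> h; apply/rowP => j; rewrite mxE; apply: contrapT => /eqP xj.
have H (s : R) : `|(s *: x) 0 j| <= M.
  apply: bndP => i; apply: mem_of_polars => q Vq.
  by rewrite dotZr /dot h// mxE mulr0.
have M0 : 0 <= M by apply: le_trans (H 0).
have := H ((M + 1) / x 0 j); rewrite mxE divfK// ger0_norm ?addr_ge0//.
by rewrite gerDl ler10.
Qed.

Hypothesis antiP : forall x, (forall i, P i x) -> forall i, P i (- (n%:R^-1 *: x)).

(** If a functional [x] separated this point from the hull, then [x] would lie in
    the intersection of the [P i], hence so would [- x / n]; but then each row of
    [X] is at most 1 on [- x / n], which contradicts the separation. *)
Lemma antipode_hull (X : 'M[R]_n) : (forall i, polars (row i X)) ->
  hull n polars (- ((n%:R ^+ 2)^-1 *: \sum_i row i X)).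
Proof.
move=> VX; have n0R : 0 < n%:R :> R by rewrite ltr0n.
have V0 : polars !=set0 by exists (row (Ordinal n0) X).
apply: contrapT => nh.
have [|||x [xh]] := separation _ _ _ nh.
- apply: compact_closed; last exact: hull_compact polars_compact.
  exact: norm_hausdorff.
- exact: hull_convex.
- have [v Vv] := V0; exists 0, (\matrix_i v); split => //.
  + by move=> j; rewrite mxE.
  + by rewrite big1 // => j _; rewrite mxE.
  + by move=> j; rewrite rowK.
  + by rewrite mul0mx.
have Px i : P i x.
  apply: mem_of_polars => q Vq; rewrite dotC; apply: xh.
  exact: sub_hull.
apply/negP; rewrite -leNgt dotNr dotZr dotC -mulrN -dotNr.
have -> : dot (\sum_i row i X) (- x) = n%:R * \sum_i dot (row i X) (- (n%:R^-1 *: x)).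
  rewrite dot_suml mulr_sumr; apply: eq_bigr => i _.
  by rewrite !dotNr dotZr; field; rewrite gt_eqF.
rewrite ler_pdivrMl ?exprn_gt0// mulr1 expr2 ler_pM2l//.
rewrite -[leRHS]mulr1 -[n in leRHS](card_ord n) mulr_natl -sumr_const; apply: ler_sum => i _.
by have [k] := VX i; apply; exact: antiP.
Qed.

(** The rows of [X] and [Y] are the [2 * n] selected polar points.  The lower bound
    on the sum confines [x] to a simplex and serves the volume estimate; the
    membership of [- x / (n * (n + 2))] serves the diameter estimate; [L] gives the
    lower bound on the volume of the intersection of the [P i]. *)
Lemma sparse_selection : exists X Y : 'M[R]_n,
  [/\ X \in unitmx, forall i, polars (row i X), forall i, polars (row i Y),
    (forall x, (forall i, dot (row i X) x <= 1) -> (forall i, dot (row i Y) x <= 1) ->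
      - n%:R ^+ 2 <= \sum_i dot (row i X) x /\
      forall i, P i (- ((n%:R * (n%:R + 2))^-1 *: x)))
  & exists L : 'M[R]_n, [/\ L \in unitmx, n`!%:R * \det L ^+ 2 <= \det X ^+ 2
    & forall y, (forall j, `|(y *m L) 0 j| <= (2 * n%:R)^-1) -> forall i, P i y]].
Proof.
have n0R : 0 < n%:R :> R by rewrite ltr0n.
have [X [uX VX maxX X1]] := max_det_basis polars_compact polars_separate.
have [a [Y [a0 a1 VY E]]] := antipode_hull VX.
exists X, Y; split => //; last first.
  have [L [uL dL cube]] := dual_cube n0 uX VX maxX.
  by exists L; split => // y yL i; apply: mem_of_polars => q; exact: cube.
move=> x Xx Yx.
have lo : - n%:R ^+ 2 <= \sum_i dot (row i X) x.
  have : - ((n%:R ^+ 2)^-1 * dot (\sum_i row i X) x) <= 1.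
    rewrite -dotZl -dotNl E dot_mulmx; apply: le_trans a1.
    by apply: ler_sum => j _; rewrite ler_piMr.
  by rewrite -mulrN ler_pdivrMl ?exprn_gt0// mulr1 dot_suml lerNl.
split => // i; apply: mem_of_polars => q Vq.
have qE : q = (q *m invmx X) *m X by rewrite mulmxKV.
set b := q *m invmx X in qE.
have b1 j : `|b 0 j| <= 1 by exact: X1.
rewrite dotNr dotZr -mulrN ler_pdivrMl ?mulr1; last first.
  by rewrite mulr_gt0// addr_gt0.
have : \sum_j (1 - b 0 j) * dot (row j X) x <= 2 * n%:R.
  rewrite mulr_natr -[n in leRHS](card_ord n) -sumr_const; apply: ler_sum => j _.
  by have := Xx j; have := b1 j; rewrite ler_norml => /andP[? ?] ?; nra.
under eq_bigr do rewrite mulrBl mul1r.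
rewrite big_split/= sumrN -dot_mulmx -qE => h.
by have := lerD h (le_refl 0); nra.
Qed.

End selection.

(** * Lebesgue measure under affine maps *)

Section affine1.
Variables (R : realType) (a w : R).
Hypothesis a0 : a != 0.
Local Notation RT := (measurableTypeR R).
Local Notation leb := (@lebesgue_measure R).

Let f (x : RT) : RT := a * x + w.

Lemma measurable_affine1 : measurable_fun [set: RT] f.
Proof.
apply: measurable_funD; last exact: measurable_cst.
by apply: measurable_funM; [exact: measurable_cst|exact: measurable_id].
Qed.

Let F : {mfun RT >-> RT} := HB.pack f (isMeasurableFun.Build _ _ _ _ f measurable_affine1).

Lemma preimage_affine1_itv (u v : R) : u < v ->
  leb (f @^-1` `]u, v]) = ((v - u) / `|a|)%:E.
Proof.
move=> uv; have aN : 0 < `|a| by rewrite normr_gt0.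
case: (ltrgtP a 0) => sa; last by move: a0; rewrite sa eqxx.
- have -> : f @^-1` `]u, v] = `[(v - w) / a, (u - w) / a[%classic.
    apply/seteqP; split => x /=; rewrite !in_itv/= /f.
      move=> /andP[h1 h2]; rewrite ler_ndivrMr// ltr_ndivlMr// (mulrC x); lra.
    rewrite ler_ndivrMr// ltr_ndivlMr// (mulrC x) => /andP[h1 h2]; lra.
  rewrite lebesgue_measure_itv /= lte_fin ltr_ndivrMr// divfK// ltrD2r uv -EFinB.
  by congr EFin; rewrite ltr0_norm//; field.
- have -> : f @^-1` `]u, v] = `](u - w) / a, (v - w) / a]%classic.
    apply/seteqP; split => x /=; rewrite !in_itv/= /f.
      move=> /andP[h1 h2]; rewrite ler_pdivlMr// ltr_pdivrMr// (mulrC x); lra.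
    rewrite ler_pdivlMr// ltr_pdivrMr// (mulrC x) => /andP[h1 h2]; lra.
  rewrite lebesgue_measure_itv /= lte_fin ltr_pdivrMr// divfK// ltrD2r uv -EFinB.
  by congr EFin; rewrite gtr0_norm//; field.
Qed.

Lemma lebesgue_affine1 (A : set RT) : measurable A ->
  leb (f @^-1` A) = (`|a|^-1%:E * leb A)%E.
Proof.
move=> mA; pose mu' : {measure set RT -> \bar R} := mscale (NngNum (normr_ge0 a)) (pushforward leb F).
have H := @lebesgue_measure_unique R (mu' measurable_affine1) _ A mA.
rewrite H.
  rewrite /mu' /mscale /= /pushforward muleA -EFinM mulVf ?mul1e// normr_eq0//.
move=> X /ocitvP[->|[[u v] /= uv ->]]; first by rewrite !measure0.
rewrite /mu' /mscale /= /pushforward /= preimage_affine1_itv//.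
rewrite lebesgue_measure_itv /= lte_fin uv -EFinB -EFinM; congr EFin.
by rewrite mulrCA divff ?mulr1// normr_eq0.
Qed.

Lemma integral_affine1 (g : RT -> \bar R) : measurable_fun [set: RT] g ->
  (forall x, 0 <= g x)%E ->
  (\int[leb]_x g (f x) = `|a|^-1%:E * \int[leb]_x g x)%E.
Proof.
move=> mg g0.
have a1 : 0 <= `|a|^-1 by rewrite invr_ge0.
have := @ge0_integral_pushforward _ _ _ _ R f measurable_affine1 leb setT g measurableT mg (fun _ _ => g0 _).
rewrite preimage_setT => <-.
rewrite -(@ge0_integral_mscale _ _ _ leb setT measurableT (NngNum a1) g mg)//.
apply: (@eq_measure_integral _ _ _ _ (mscale (NngNum a1) leb) (pushforward leb F)) => A mA _.
exact: lebesgue_affine1.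
Qed.

End affine1.

Section volume.
Variable R : realType.
Local Notation RT := (measurableTypeR R).
Local Notation leb := (@lebesgue_measure R).

Definition row_of n (t : n.-tuple RT) : 'rV[R]_n := \row_i tnth t i.

(** [volume] is a measure on tuples transported along [row_of], and is only well
    behaved on the sets measurable in this sense; closed sets are
    ([closed_rv_measurable]). *)
Definition rv_measurable n (A : set 'rV[R]_n) := measurable (@row_of n @^-1` A).

Lemma row_of_cons n (x : RT) (t : n.-tuple RT) :
  row_of [tuple of x :: t] = row_mx x%:M (row_of t) :> 'rV[R]_(1 + n).
Proof.
apply/rowP => i; case: (split_ordP i) => j ->; rewrite [LHS]mxE.
  by rewrite row_mxEl ord1 mxE eqxx mulr1n (_ : lshift n 0 = ord0) ?tnth0//; exact/val_inj.
by rewrite row_mxEr mxE (_ : rshift 1 j = lift ord0 j) ?tnthS//; exact/val_inj.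
Qed.

Definition head_tail n (p : RT * n.-tuple RT) : 'rV[R]_(1 + n) :=
  row_mx p.1%:M (row_of p.2).

Lemma rv_measurableS n (A : set 'rV[R]_(1 + n)) :
  rv_measurable A -> measurable (@head_tail n @^-1` A).
Proof.
move=> mA; rewrite (_ : _ @^-1` A =
    (fun p : RT * n.-tuple RT => [tuple of p.1 :: p.2]) @^-1` (@row_of (1 + n) @^-1` A)).
  by rewrite -[X in measurable X]setTI; exact: measurable_cons.
by apply/seteqP; split => p /=; rewrite row_of_cons.
Qed.

Lemma volumeS n (A : set 'rV[R]_(1 + n)) :
  volume A = (leb \x lebesgue_tuple R n)%E (@head_tail n @^-1` A).
Proof.
rewrite /volume [LHS]lebesgue_tupleS; congr (_ _).
by apply/seteqP; split => p /=; rewrite -/(row_of _) row_of_cons.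
Qed.

Lemma measurable_row_of_affine n m (M : 'M[R]_(n, m)) (w : 'rV[R]_m) i :
  measurable_fun [set: n.-tuple RT] (fun t => (row_of t *m M + w) 0 i : RT).
Proof.
rewrite (_ : (fun _ => _) = (fun t : n.-tuple RT => \sum_k tnth t k * M k i + w 0 i)).
  apply: measurable_funD; last exact: measurable_cst.
  apply: measurable_sum => k; apply: measurable_funM; last exact: measurable_cst.
  exact: measurable_tnth.
apply/funext => t; rewrite !mxE; congr (_ + _); apply: eq_bigr => k _.
by rewrite mxE.
Qed.

Lemma rv_measurable_affine n m (M : 'M[R]_(n, m)) (w : 'rV[R]_m) (A : set 'rV[R]_m) :
  rv_measurable A -> rv_measurable [set x | A (x *m M + w)].
Proof.
move=> mA.
pose g (t : n.-tuple RT) : m.-tuple RT := [tuple (row_of t *m M + w) 0 i | i < m].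
have mg : measurable_fun [set: n.-tuple RT] g.
  apply/measurable_fun_tnthP => i.
  rewrite (_ : _ \o _ = fun t => (row_of t *m M + w) 0 i); first exact: measurable_row_of_affine.
  by apply/funext => t /=; rewrite tnth_mktuple.
rewrite /rv_measurable (_ : _ @^-1` _ = g @^-1` (@row_of m @^-1` A)).
  by rewrite -[X in measurable X]setTI; exact: mg.
have gE t : row_of (g t) = row_of t *m M + w.
  by apply/rowP => i; rewrite [LHS]mxE tnth_mktuple.
by apply/seteqP; split => t /=; rewrite gE.
Qed.

Lemma rv_measurable_section n (A : set 'rV[R]_(1 + n)) x :
  rv_measurable A -> rv_measurable [set y | A (row_mx x%:M y)].
Proof.
move=> /rv_measurableS /(@measurable_xsection _ _ _ _ _ x).
by congr measurable; apply/seteqP; split => t /=; rewrite /xsection /= inE.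
Qed.

Lemma volume_section n (A : set 'rV[R]_(1 + n)) :
  volume A = (\int[leb]_x volume [set y | A (row_mx x%:M y)])%E.
Proof.
rewrite volumeS; apply: eq_integral => x _ /=; congr (_ _).
by apply/seteqP; split => t /=; rewrite /xsection /= inE.
Qed.

Lemma measurable_volume_section n (A : set 'rV[R]_(1 + n)) : rv_measurable A ->
  measurable_fun [set: RT] (fun x => volume [set y | A (row_mx x%:M y)]).
Proof.
move=> /rv_measurableS mA; have := measurable_fun_xsection (lebesgue_tuple R n) mA.
congr measurable_fun; apply/funext => x /=; congr (_ _).
by apply/seteqP; split => t /=; rewrite /xsection /= inE.
Qed.

Definition scales_volume n (M : 'M[R]_n) := forall (w : 'rV[R]_n) A, rv_measurable A ->
  volume [set x | A (x *m M + w)] = (`|\det M|^-1%:E * volume A)%E.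

Lemma scales_volumeM n (M N : 'M[R]_n) : scales_volume M -> scales_volume N -> scales_volume (M *m N).
Proof.
move=> sM sN w A mA.
have := sM 0 _ (rv_measurable_affine N w mA).
rewrite (sN w A mA) muleA -EFinM -invfM -normrM -det_mulmx => <-.
by congr volume; apply/seteqP; split => x /=; rewrite addr0 mulmxA.
Qed.

(** Fubini, integrating over the first coordinate last: each section is an affine
    image under [D], with a translation depending on the first coordinate, which is
    why [scales_volume] includes translations. *)
Lemma scales_volume_ublock n (a : R) (b : 'rV[R]_n) (D : 'M[R]_n) : a != 0 -> scales_volume D ->
  scales_volume (block_mx a%:M b 0 D).
Proof.
move=> a0 sD w A mA.
rewrite volume_section [in RHS]volume_section det_ublock det_scalar1.
pose g (x : RT) := volume [set y | A (row_mx x%:M y)].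
have g0 x : (0 <= g x)%E by exact: measure_ge0.
transitivity (\int[leb]_x (`|\det D|^-1%:E * g (a * x + w 0 0)%R))%E.
  apply: eq_integral => x _.
  rewrite /g -(sD (x *: b + rsubmx w)); last exact: rv_measurable_section.
  congr volume.
  have E y : row_mx x%:M y *m block_mx a%:M b 0 D + w =
      row_mx (a * x + w 0 0)%:M (y *m D + (x *: b + rsubmx w)).
    rewrite mul_row_block mulmx0 addr0 !mul_scalar_mx scale_scalar_mx.
    rewrite -[w in LHS]hsubmxK add_row_mx; congr row_mx; last by rewrite -addrA addrCA addrA.
    rewrite raddfD /= mulrC; congr (_ + _).
    by rewrite [LHS]mx11_scalar mxE (_ : lshift n 0 = 0)//; exact/val_inj.
  by apply/seteqP; split => y /=; rewrite E.
have mg : measurable_fun [set: RT] g by exact: measurable_volume_section.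
have mgf : measurable_fun [set: RT] (fun x => g (a * x + w 0 0)%R).
  exact: (measurableT_comp mg (measurable_affine1 a (w 0 0))).
rewrite (ge0_integralZl_EFin leb measurableT) ?invr_ge0//.
by rewrite integral_affine1// muleA -EFinM -invfM -normrM mulrC.
Qed.

Definition shear n (c : 'cV[R]_n) : 'M[R]_(1 + n) := block_mx 1%:M 0 c 1%:M.

(** Fubini in the other order: for each value of the remaining coordinates the
    first coordinate is merely translated. *)
Lemma volume_shear n (c : 'cV[R]_n) A : rv_measurable A ->
  volume [set x | A (x *m shear c)] = volume A.
Proof.
move=> mA; have mA' : rv_measurable [set x | A (x *m shear c)].
  have := rv_measurable_affine (shear c) 0 mA.
  by congr rv_measurable; apply/seteqP; split => x /=; rewrite addr0.
have P12 (B : set (RT * n.-tuple RT)) : measurable B ->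
    (leb \x lebesgue_tuple R n)%E B = (leb \x^ lebesgue_tuple R n)%E B.
  pose m2 : {measure set (RT * n.-tuple RT) -> \bar R} := (leb \x^ lebesgue_tuple R n)%E.
  move=> mB; apply: (@product_measure_unique _ _ _ _ _ leb (lebesgue_tuple R n) m2) => //.
  by move=> X Y mX mY; exact: product_measure2E.
rewrite !volumeS !P12; [|exact: rv_measurableS|exact: rv_measurableS].
apply: eq_integral => t _ /=.
pose B := ysection (@head_tail n @^-1` A) t.
have mB : measurable B by apply: measurable_ysection; exact: rv_measurableS.
have := lebesgue_affine1 ((row_of t *m c) 0 0) (oner_neq0 R) mB.
rewrite normr1 invr1 mul1e -/B => <-; congr (_ _).
have E x : row_mx x%:M (row_of t) *m shear c =
    row_mx (1 * x + (row_of t *m c) 0 0)%:M (row_of t).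
  rewrite /shear mul_row_block mulmx0 !mulmx1 add0r mul1r.
  by rewrite [row_of t *m c in LHS]mx11_scalar -raddfD.
by apply/seteqP; split => x; rewrite /B /ysection /= !inE /head_tail /= E.
Qed.

(** Gaussian elimination.  A matrix with nonzero pivot is a shear times a block
    triangular matrix whose lower block is handled by induction; a zero pivot is
    first made nonzero by adding a lower row to the first one. *)
Theorem volume_affine n (M : 'M[R]_n) : M \in unitmx -> scales_volume M.
Proof.
elim: n M => [|n IHn] M uM.
  move=> w A mA; rewrite det_mx00 normr1 invr1 mul1e.
  by congr volume; apply/seteqP; split => x /=; rewrite [x *m M + w]thinmx0 [x]thinmx0.
rewrite -[n.+1]/(1 + n)%N in M uM *.
have s1 : scales_volume (1%:M : 'M[R]_n) by apply: IHn; exact: unitmx1.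
have pivot (N : 'M[R]_(1 + n)) : N \in unitmx -> N 0 0 != 0 -> scales_volume N.
  move=> uN a0; set a := N 0 0 in a0.
  pose c := a^-1 *: dlsubmx N; pose D := drsubmx N - c *m ursubmx N.
  have NE : N = shear c *m block_mx a%:M (ursubmx N) 0 D.
    rewrite /shear mulmx_block !mul1mx !mul0mx !addr0.
    rewrite mul_mx_scalar scalerA divff// scale1r addrC subrK -[LHS]submxK.
    congr (block_mx _ _ _ _); rewrite [LHS]mx11_scalar !mxE; congr ((N _ _)%:M); exact/val_inj.
  have uD : D \in unitmx.
    move: uN; rewrite NE unitmx_mul => /andP[_].
    by rewrite unitmxE det_ublock unitrM -unitmxE => /andP[].
  move=> w A mA; have := scales_volume_ublock (ursubmx N) a0 (IHn D uD) w mA.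
  have := rv_measurable_affine (block_mx a%:M (ursubmx N) 0 D) w mA.
  move=> /(volume_shear c) <- E.
  rewrite [in RHS]NE det_mulmx {1}/shear det_lblock !det1 !mul1r -E.
  by congr volume; apply/seteqP; split => x /=; rewrite -mulmxA -NE.
have [a0|] := eqVneq (M 0 0) 0; last exact: pivot.
have [j Mj] : exists j, M (rshift 1 j) 0 != 0.
  apply: contrapT => nj; move: uM; rewrite unitmxE.
  rewrite (expand_det_col _ 0) big1 ?unitr0// => i _.
  case: (@split_ordP 1 n i) => k ->.
    by rewrite ord1 (_ : lshift n 0 = 0) ?a0 ?mul0r//; exact/val_inj.
  suff -> : M (rshift 1 k) 0 = 0 by rewrite mul0r.
  by apply/eqP; apply: contrapT => /negP h; apply: nj; exists k.
pose e : 'rV[R]_n := delta_mx 0 j.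
pose U b : 'M[R]_(1 + n) := block_mx 1%:M b 0 1%:M.
have ME : M = U (- e) *m (U e *m M).
  rewrite mulmxA /U mulmx_block !mul1mx !mulmx1 !mul0mx !mulmx0 !addr0 !add0r subrr.
  by rewrite -scalar_mx_block mul1mx.
rewrite ME; apply: scales_volumeM; first exact: scales_volume_ublock (oner_neq0 R) s1.
apply: pivot.
  by rewrite unitmx_mul uM andbT unitmxE /U det_ublock !det1 mulr1 unitr1.
have -> : (U e *m M) 0 0 = M (rshift 1 j) 0; last by [].
rewrite mxE big_split_ord /= big_ord1 /U.
rewrite (_ : lshift n 0 = 0) ?a0 ?mulr0 ?add0r; last exact/val_inj.
rewrite (bigD1 j)//= big1 => [|k kj].
  rewrite addr0 -(_ : lshift n 0 = 0 :> 'I_(1 + n)); last exact/val_inj.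
  by rewrite block_mxEur mxE !eqxx mul1r.
rewrite -(_ : lshift n 0 = 0 :> 'I_(1 + n)); last exact/val_inj.
by rewrite block_mxEur mxE (negbTE kj) andbF mul0r.
Qed.

End volume.

(** * Measurability and volume of coverings *)

Section covering.
Variable R : realType.
Local Notation RT := (measurableTypeR R).
Local Notation leb := (@lebesgue_measure R).

Lemma box_measurable n (B : 'I_n -> set RT) : (forall i, measurable (B i)) ->
  rv_measurable [set x : 'rV[R]_n | forall i, B i (x 0 i)].
Proof.
move=> /measurable_tuple_box; congr measurable.
by apply/seteqP; split => t /= h i; have := h i; rewrite mxE.
Qed.

Lemma volume_box n (B : 'I_n -> set RT) : (forall i, measurable (B i)) ->
  volume [set x : 'rV[R]_n | forall i, B i (x 0 i)] = (\prod_(i < n) leb (B i))%E.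
Proof.
move=> mB; rewrite -lebesgue_tuple_box// /volume; congr (_ _).
by apply/seteqP; split => t /= h i; have := h i; rewrite mxE.
Qed.

Let near_center_le (q x y d e : R) : 2 * d <= e ->
  q - d < y < q + d -> x - d < q < x + d -> `|y - x| <= e.
Proof. by move=> ? /andP[? ?] /andP[? ?]; rewrite ler_norml; apply/andP; split; lra. Qed.

(** An open set is the union of the countably many rational boxes it contains. *)
Lemma open_rv_measurable n (U : set 'rV[R]_n) : open U -> rv_measurable U.
Proof.
move=> oU.
pose box (p : n.-tuple rat * nat) : set 'rV[R]_n :=
  [set x | forall i, `]ratr (tnth p.1 i) - p.2.+1%:R^-1, ratr (tnth p.1 i) + p.2.+1%:R^-1[%classic (x 0 i)].
pose F p := if `[< box p `<=` U >] then box p else set0.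
have -> : U = \bigcup_p F p.
  apply/seteqP; split => [x Ux|x [p _]]; last by rewrite /F; case: asboolP => // + ?; exact.
  have [e e0 Ue] : exists2 e : R, 0 < e & forall h : 'rV[R]_n, (forall j, `|h 0 j| <= e) -> U (x + h).
    by apply: interior_cube; exact: open_nbhs_nbhs.
  pose k := Num.truncn (2 / e).
  have k0 : 0 < k.+1%:R^-1 :> R by rewrite invr_gt0.
  have ke : 2 * k.+1%:R^-1 <= e.
    by rewrite ler_pdivrMr// mulrC -ler_pdivrMr// ltW// truncnS_gt.
  have [i|q qx] := @choice 'I_n rat (fun i q => ratr q \in `]x 0 i - k.+1%:R^-1, x 0 i + k.+1%:R^-1[).
    by apply: rat_in_itvoo; rewrite ltrBlDr -addrA ltrDl addr_gt0.
  exists ([tuple q i | i < n], k) => //; rewrite /F; case: asboolP => /= [_ i|].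
    move: (k.+1%:R^-1) k0 (qx i) => d d0; rewrite !in_itv/= tnth_mktuple ?in_itv/=.
    by case/andP => h1 h2; rewrite ltrBlDr h2 -ltrBlDr h1.
  case=> y /= yb; rewrite -[y](subrK x) addrC; apply: Ue => j.
  move: (yb j) (qx j); rewrite !in_itv/= tnth_mktuple ?in_itv/= !mxE.
  exact: near_center_le ke.
rewrite /rv_measurable preimage_bigcup.
apply: countable_bigcupT_measurable; first exact: countableP.
move=> p; rewrite /F; case: asboolP => _; last by rewrite preimage_set0.
by apply: (@box_measurable n (fun i => _)) => i; exact: measurable_itv.
Qed.

Lemma closed_rv_measurable n (A : set 'rV[R]_n) : closed A -> rv_measurable A.
Proof.
move=> cA; have := open_rv_measurable (closed_openC cA).
by rewrite /rv_measurable preimage_setC => /measurableC; rewrite setCK.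
Qed.

Lemma volume_le n (A B : set 'rV[R]_n) : rv_measurable A -> rv_measurable B ->
  A `<=` B -> (volume A <= volume B)%E.
Proof.
by move=> mA mB AB; apply: le_measure; rewrite ?inE// => t; exact: AB.
Qed.

Lemma volume_cover_le n (I : Type) (s : seq I) (F : I -> set 'rV[R]_n) (A : set 'rV[R]_n) c :
  rv_measurable A -> (forall i, rv_measurable (F i)) -> (forall i, volume (F i) <= c%:E)%E ->
  A `<=` \big[setU/set0]_(i <- s) F i -> (volume A <= ((size s)%:R * c)%:E)%E.
Proof.
move=> mA mF Fc; elim: s A mA => [|i s IHs] A mA.
  rewrite big_nil subset0 => ->; rewrite mul0r; suff -> : volume (set0 : set 'rV[R]_n) = 0%E by [].
  exact: (measure0 (lebesgue_tuple R n)).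
rewrite big_cons => AF.
have mAF : rv_measurable (A `\` F i) by apply: measurableD => //; exact: mF.
have hAF : (volume (A `\` F i) <= ((size s)%:R * c)%:E)%E.
  by apply: IHs => // x [/AF []].
apply: (@le_trans _ _ (volume (F i `|` (A `\` F i)))).
  apply: volume_le => //; first by apply: measurableU => //; exact: mF.
  by move=> x Ax; have [|] := pselect (F i x); [left|right].
apply: (@le_trans _ _ (volume (F i) + volume (A `\` F i)))%E.
  by apply: measureU2 => //; exact: mF.
by rewrite /= -natr1 mulrDl mul1r addrC EFinD leeD.
Qed.

(** In the coordinates [z = x *m X + w], a grid of cubes of edge [h] is used.  The
    cubes meeting the simplex are indexed by the vectors of natural numbers of sum
    at most [n], and there are ['C(n + n, n)] of these. *)
Lemma volume_simplex n (A : set 'rV[R]_n) (X : 'M[R]_n) (w : 'rV[R]_n) h :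
  0 < h -> X \in unitmx -> rv_measurable A ->
  (forall x, A x -> (forall i, 0 <= (x *m X + w) 0 i) /\ \sum_i (x *m X + w) 0 i <= n%:R * h) ->
  (volume A <= (4 ^+ n * h ^+ n / `|\det X|)%:E)%E.
Proof.
move=> h0 uX mA AS.
pose B (k : n.-tuple 'I_n.+1) : set 'rV[R]_n :=
  [set x | forall i, `[(tnth k i)%:R * h, (tnth k i).+1%:R * h]%classic (x 0 i)].
have mB k : rv_measurable (B k).
  by apply: (@box_measurable n (fun i => `[(tnth k i)%:R * h, (tnth k i).+1%:R * h]%classic)) => i; exact: measurable_itv.
pose s := enum [set t : n.-tuple 'I_n.+1 | (\sum_(i <- t) i <= n)%N]%SET.
apply: le_trans (@volume_cover_le n _ s (fun k => [set x | B k (x *m X + w)]) A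
  (h ^+ n / `|\det X|) mA _ _ _) _.
- by move=> k; exact: rv_measurable_affine.
- move=> k; rewrite volume_affine//.
  rewrite (@volume_box n (fun i => `[(tnth k i)%:R * h, (tnth k i).+1%:R * h]%classic)); last first.
    by move=> i; exact: measurable_itv.
  rewrite (eq_bigr (fun=> h%:E)); last first.
    move=> i _; rewrite lebesgue_measure_itv /= lte_fin ltr_pM2r// ltr_nat ltnSn -EFinB.
    by rewrite -mulrBl -natr1 addrAC subrr add0r mul1r.
  by rewrite prodEFin prodr_const card_ord -EFinM mulrC.
- move=> x Ax; have [x0 xs] := AS _ Ax.
  pose k i := Num.truncn ((x *m X + w) 0 i / h).
  have kP i : (k i)%:R * h <= (x *m X + w) 0 i < (k i).+1%:R * h.
    have := truncn_itv (divr_ge0 (x0 i) (ltW h0)).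
    by rewrite ler_pdivlMr// ltr_pdivrMr.
  have ks : (\sum_i k i <= n)%N.
    rewrite -(ler_nat R) natr_sum -(ler_pM2r h0) mulr_suml; apply: le_trans xs.
    by apply: ler_sum => i _; have /andP[] := kP i.
  have kn i : (k i < n.+1)%N by rewrite ltnS (leq_trans _ ks)// (bigD1 i)//= leq_addr.
  pose t := [tuple Ordinal (kn i) | i < n].
  have ts : t \in s.
    by rewrite mem_enum inE big_tuple; under eq_bigr do rewrite tnth_mktuple.
  rewrite -bigcup_seq; exists t => //.
  move=> i; rewrite /= in_itv/= tnth_mktuple /=.
  by have /andP[? ?] := kP i; apply/andP; split => //; exact: ltW.
rewrite lee_fin -cardE card_partial_ord_partitions mulrA.
rewrite ler_wpM2r ?invr_ge0// ler_wpM2r//; first by rewrite exprn_ge0// ltW.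
by rewrite -natrX ler_nat central_bin_le.
Qed.

End covering.

(** * The volume constant, diameters and the theorem *)

(** Both sides are squared, so that the exponent [3 * n / 2] becomes an integer.
    The factor [n`!] is replaced by [n ^ n / 4 ^ n], and [n.+1 <= 2 * n] then
    leaves [256 <= 8 ^ 3]. *)
Lemma volume_ratio (R : realType) n (D l : R) : (0 < n)%N -> 0 < D -> 0 < l ->
  n`!%:R * l ^+ 2 <= D ^+ 2 ->
  4 ^+ n * n.+1%:R ^+ n / D <= (8 * n%:R) `^ (3 * n%:R / 2) * (n%:R ^- n / l).
Proof.
move=> n0 D0 l0 h; have n0R : 0 < n%:R :> R by rewrite ltr0n.
have nn0 : 0 < n%:R ^+ n :> R by rewrite exprn_gt0.
set F := _ `^ _; have F0 : 0 <= F by exact: powR_ge0.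
have F2 : F ^+ 2 = (8 * n%:R) ^+ (3 * n).
  have b0 : 0 <= 8 * n%:R :> R by rewrite mulr_ge0// ltW.
  rewrite -powR_mulrn// /F -powRrM -powR_mulrn//; congr (_ `^ _).
  by rewrite natrM divfK.
rewrite ler_pdivrMr// (_ : _ * D = F * D / (l * n%:R ^+ n)); last first.
  by rewrite invfM; ring.
rewrite ler_pdivlMr ?mulr_gt0// mulrA.
rewrite -ler_sqr ?nnegrE; last 2 first.
- by rewrite !mulr_ge0 ?exprn_ge0// ltW.
- by rewrite mulr_ge0// ltW.
rewrite [leRHS]exprMn F2.
have h2 : n%:R ^+ n * l ^+ 2 <= 4 ^+ n * D ^+ 2.
  apply: (@le_trans _ _ (4 ^+ n * (n`!%:R * l ^+ 2))).
    rewrite mulrA ler_wpM2r ?sqr_ge0// -!natrX -natrM ler_nat mulnC.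
    exact: expn_le_fact_bin.
  by rewrite ler_wpM2l// exprn_ge0.
have -> : (4 ^+ n * n.+1%:R ^+ n * l * n%:R ^+ n) ^+ 2 =
   (16 * n.+1%:R ^+ 2 * n%:R) ^+ n * (n%:R ^+ n * l ^+ 2).
  rewrite mulrA -[in RHS]exprMn (_ : _ * l * _ = (4 * n.+1%:R * n%:R) ^+ n * l).
    rewrite [LHS]exprMn [X in X * _ = _]exprAC; congr (_ ^+ n * _); ring.
  by rewrite !exprMn; ring.
apply: le_trans (ler_wpM2l _ h2) _; first by rewrite exprn_ge0// !mulr_ge0// ?exprn_ge0// ltW.
rewrite mulrA -exprMn ler_wpM2r ?sqr_ge0// exprM; apply: lerXn2r; rewrite ?nnegrE.
- by rewrite !mulr_ge0// ?exprn_ge0// ltW.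
- by rewrite exprn_ge0// mulr_ge0// ltW.
have : (1 : R) <= n%:R by rewrite ler1n.
rewrite -[n.+1]addn1 natrD; move: (n%:R : R) => x x1.
have x2 : (x + 1) ^+ 2 <= (2 * x) ^+ 2 by apply: lerXn2r; rewrite ?nnegrE; lra.
have : x * (x + 1) ^+ 2 <= x * (2 * x) ^+ 2 by rewrite ler_wpM2l//; lra.
have : 0 <= x ^+ 3 by rewrite exprn_ge0//; lra.
by rewrite !expr2 !exprS expr0; lra.
Qed.

Lemma enormZ (R : realType) n (a : R) (x : 'rV[R]_n) : enorm (a *: x) = `|a| * enorm x.
Proof.
rewrite /enorm -sqrtr_sqr -sqrtrM ?sqr_ge0// mulr_sumr.
by congr Num.sqrt; apply: eq_bigr => i _; rewrite mxE exprMn.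
Qed.

Lemma diameter_antihomothety (R : realType) n (A B : set 'rV[R]_n) (p : 'rV[R]_n) (N : R) :
  0 < N -> (forall x, A x -> B (p - N^-1 *: (x - p))) -> (diameter A <= N%:E * diameter B)%E.
Proof.
move=> N0 AB; apply: ge_ereal_sup => _ [x Ax [y Ay <-]].
have Bx := AB _ Ax; have By := AB _ Ay.
set x' := p - _ in Bx; set y' := p - _ in By.
have -> : x - y = N *: (y' - x').
  by apply/rowP => i; rewrite !mxE; field; rewrite gt_eqF.
rewrite enormZ gtr0_norm// EFinM lee_pmul2l// ?lte_fin//.
by apply: ereal_sup_ubound; exists y' => //; exists x'.
Qed.

Theorem theorem4 (R : realType) :
  exists c : R, 0 < c /\
  forall (d n : nat) (K : 'I_n -> set 'rV[R]_d),
    (2 <= d)%N ->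
    (forall i, closed (K i)) ->
    (forall i, convex (K i)) ->
    convex_body (\bigcap_i K i) ->
    exists sigma : {set 'I_n},
      [/\ (#|sigma| <= 2 * d)%N,
          (volume (\bigcap_(i in [set` sigma]) K i)
             <= ((c * d%:R) `^ (3 * d%:R / 2))%:E * volume (\bigcap_i K i))%E
        & (diameter (\bigcap_(i in [set` sigma]) K i)
             <= (2 * d%:R ^+ 2)%:E * diameter (\bigcap_i K i))%E].
Proof.
exists 8; split => // d n K d2 clK cvK [cK convK intK].
have d0 : (0 < d)%N by exact: leq_trans d2.
have d0R : 0 < d%:R :> R by rewrite ltr0n.
have sK i : segment_closed (K i) by exact: convex_segment_closed.
have [p [[r r0 cube] anti]] := minkowski_center d0 cK (convex_segment_closed convK) intK.
pose P i : set 'rV[R]_d := [set x | K i (p + x)].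
have [M KM] := compact_coord_bounded cK.
have [M' pM'] := compact_coord_bounded (@compact_set1 _ p).
have [|||||X [Y [uX VX VY sel [L [uL LX Lcube]]]]] :=
  @sparse_selection R d n P d0 _ _ r r0 _ (M + M') _ _.
- by move=> i; exact: closed_translate.
- by move=> i; exact: segment_closed_translate.
- by move=> i x /cube; apply.
- move=> x Px j; have Kx : (\bigcap_i K i) (p + x) by move=> i _; exact: Px.
  rewrite -(addKr (p 0 j) (x 0 j)) addrC; apply: le_trans (ler_normB _ _) _.
  by rewrite lerD ?pM'//; have := KM _ Kx j; rewrite mxE.
- by move=> x Px i; rewrite /P /=; apply: anti => // k _; exact: Px.
have [f fX] := choice VX; have [g gY] := choice VY.
pose sigma := ([set f i | i : 'I_d] :|: [set g i | i : 'I_d])%SET.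
pose Ks := \bigcap_(i in [set` sigma]) K i.
have KsX x : Ks x -> forall i, dot (row i X) (x - p) <= 1.
  move=> Kx i; apply: fX; rewrite /P /= addrC subrK; apply: Kx.
  by apply/finset.setUP; left; apply/imsetP; exists i.
have KsY x : Ks x -> forall i, dot (row i Y) (x - p) <= 1.
  move=> Kx i; apply: gY; rewrite /P /= addrC subrK; apply: Kx.
  by apply/finset.setUP; right; apply/imsetP; exists i.
have clKs : closed Ks by apply: closed_bigI => i _; exact: clK.
have clK' : closed (\bigcap_i K i) by apply: closed_bigI => i _; exact: clK.
exists sigma; split.
- apply: leq_trans (leq_card_setU _ _) _.
  by rewrite mul2n -addnn leq_add// (leq_trans (leq_imset_card _ _))// card_ord.
- have DX0 : 0 < `|\det X| by rewrite normr_gt0 -unitfE -unitmxE.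
  have DL0 : 0 < `|\det L| by rewrite normr_gt0 -unitfE -unitmxE.
  have up : (volume Ks <= (4 ^+ d * d.+1%:R ^+ d / `|\det X|)%:E)%E.
    have E x i : (x *m - X^T + (const_mx 1 + p *m X^T)) 0 i = 1 - dot (row i X) (x - p).
      rewrite -dot_row mulmxBl mulmxN; move: (x *m X^T) (p *m X^T) => a b.
      by rewrite !mxE; ring.
    have -> : `|\det X| = `|\det (- X^T)|.
      by rewrite -scaleN1r detZ det_tr normrM normrX normrN1 expr1n mul1r.
    apply: (@volume_simplex R d Ks (- X^T) (const_mx 1 + p *m X^T)) => //.
    - by rewrite -scaleN1r unitmxZ ?unitmx_tr ?unitrN1.
    - exact: closed_rv_measurable.
    move=> x Kx; split => [i|]; first by rewrite E subr_ge0 KsX.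
    under eq_bigr do rewrite E.
    have [h _] := sel _ (KsX _ Kx) (KsY _ Kx).
    rewrite big_split/= sumrN sumr_const card_ord -[d.+1]addn1 natrD mulrDr mulr1 addrC.
    by rewrite lerD2r lerNl -expr2.
  have lo : ((d%:R ^- d / `|\det L|)%:E <= volume (\bigcap_i K i))%E.
    pose B (i : 'I_d) : set (measurableTypeR R) := `[- (2 * d%:R)^-1, (2 * d%:R)^-1]%classic.
    have mB i : measurable (B i) by exact: measurable_itv.
    have := volume_affine uL (- (p *m L)) (box_measurable mB).
    rewrite volume_box// (eq_bigr (fun=> d%:R^-1%:E)); last first.
      have h0 : 0 < (2 * d%:R)^-1 :> R by rewrite invr_gt0 mulr_gt0.
      move=> i _; rewrite lebesgue_measure_itv /= lte_fin ifT; last by lra.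
      by rewrite -EFinB; congr EFin; field; rewrite gt_eqF.
    rewrite prodEFin prodr_const card_ord exprVn -EFinM mulrC => <-.
    apply: volume_le.
    - exact: rv_measurable_affine (box_measurable mB).
    - exact: closed_rv_measurable.
    move=> x xB i _; suff : P i (x - p) by rewrite /P /= addrC subrK.
    apply: Lcube => j.
    have := xB j; rewrite /B /= in_itv/= mulmxBl => /andP[h1 h2].
    by rewrite ler_norml h1 h2.
  apply: le_trans up _.
  apply: (@le_trans _ _ (((8 * d%:R) `^ (3 * d%:R / 2))%:E * (d%:R ^- d / `|\det L|)%:E)%E).
    rewrite -EFinM lee_fin; apply: volume_ratio => //.
    by rewrite !real_normK ?num_real.
  by apply: lee_wpmul2l => //; rewrite lee_fin powR_ge0.
- apply: (@le_trans _ _ ((d%:R * (d%:R + 2))%:E * diameter (\bigcap_i K i))%E).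
    apply: (@diameter_antihomothety _ _ _ _ p); first by rewrite mulr_gt0// addr_gt0.
    move=> x Kx i _; have [_ h] := sel _ (KsX _ Kx) (KsY _ Kx).
    exact: h.
  apply: lee_wpmul2r.
    have Kp : (\bigcap_i K i) (p + 0) by apply: cube => j; rewrite mxE normr0 ltW.
    apply: (@le_trans _ _ (enorm (p + 0 - (p + 0)))%:E); first by rewrite lee_fin sqrtr_ge0.
    by apply: ereal_sup_ubound; exists (p + 0) => //; exists (p + 0).
  (* Here 2 <= d is used: d + 2 <= 2 * d. *)
  rewrite lee_fin expr2.
  have : (2 : R) <= d%:R by rewrite ler_nat.
  by nra.
Qed.
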